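(* There exist non-trivial warped product pointwise semi-slant submanifolds of the form $M_T\times_fM_\theta$ in Kaehler manifolds, with $M_T$ a holomorphic submanifold and $M_\theta$ a proper pointwise slant submanifold. Specifically, let $M$ be the submanifold of $\mathbb R^{10}$ parametrized, for $t,s\in\mathbb R\setminus\{0,1\}$ and $u,v\in(0,\tfrac{\pi}{2})$, by $$(x_1,\dots,x_{10})=(t\cos u,\ s\cos u,\ t\cos v,\ s\cos v,\ t\sin u,\ s\sin u,\ t\sin v,\ s\sin v,\ u,\ v).$$ Let $D^T$ be the distribution on $M$ spanned by the coordinate fields $\partial_t,\partial_s$ and $D^\theta$ the one spanned by $\partial_u,\partial_v$. Then $M$ is a pointwise semi-slant submanifold with holomorphic distribution $D^T$ and pointwise slant distribution $D^\theta$ whose slant function is $\cos^{-1}\!\big(\tfrac{1}{t^2+s^2+1}\big)$; both distributions are integrable; the induced metric is $$g=2\,dt^2+2\,ds^2+(t^2+s^2+1)(du^2+dv^2);$$ and hence $M$ is a non-trivial warped product $M_T\times_fM_\theta$, where $M_T$ and $M_\theta$ are integral manifolds of $D^T$ and $D^\theta$, with warping function $f=\sqrt{t^2+s^2+1}$.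
   Context: $\mathbb R^{10}$ carries the Euclidean metric and the canonical complex structure $J\partial_{x_{2i-1}}=\partial_{x_{2i}}$, $J\partial_{x_{2i}}=-\partial_{x_{2i-1}}$ ($i=1,\dots,5$), and is thereby a Kaehler manifold. A distribution $D$ on a submanifold $M$ is holomorphic if $JD=D$. It is pointwise slant with slant function $\theta$ if at each $p\in M$ the angle between $JX$ and $D_p$ equals $\theta(p)$ for every nonzero $X\in D_p$. A submanifold $M$ is pointwise semi-slant if $TM=D^T\oplus D^\theta$ orthogonally, with $D^T$ holomorphic and $D^\theta$ pointwise slant. A submanifold $N$ is holomorphic if $J(T_pN)\subset T_pN$ for all $p\in N$. It is pointwise slant if at each $p\in N$ the angle between $JX$ and $T_pN$ is the same for all nonzero $X\in T_pN$, and proper pointwise slant if moreover this angle is never $\pi/2$. For Riemannian manifolds $(B,g_1)$, $(F,g_2)$ and $f:B\to(0,\infty)$, the warped product $B\times_fF$ is $B\times F$ with metric $\pi^*g_1+(f\circ\pi)^2\eta^*g_2$, where $\pi,\eta$ are the projections. It is non-trivial if $f$ is not constant. *)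

(* Defs.v *)
From HB Require Import structures.
From mathcomp Require Import all_boot all_order all_algebra.
From mathcomp Require Import all_classical all_reals all_analysis.

Set Implicit Arguments.
Unset Strict Implicit.
Unset Printing Implicit Defensive.
Import Order.TTheory GRing.Theory Num.Theory.
Import numFieldNormedType.Exports.
Local Open Scope classical_set_scope.
Local Open Scope ring_scope.

(* R^n is 'rV[R]_n.  Its library norm is the sup norm, used only for topology
   and differentiability; lengths and angles come from a metric field
   g : 'rV[R]_n -> 'M[R]_n.  Tangent vectors are row vectors, and an
   endomorphism field J acts on the right: J X is X *m J p. *)

Fixpoint Ck (R : realType) (V W : normedModType R) (k : nat)
    (U : set V) (f : V -> W) : Prop :=
  match k with
  | 0%N => forall x, U x -> {for x, continuous f}
  | k'.+1 => (forall x, U x -> differentiable f x) /\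
             (forall v : V, Ck k' U (fun x => 'D_v f x))
  end.

(* Meant for open U. *)
Definition smooth (R : realType) (V W : normedModType R)
    (U : set V) (f : V -> W) : Prop := forall k, Ck k U f.

(* Smoothness on an arbitrary subset: local existence of smooth extensions. *)
Definition smooth_on (R : realType) (V W : normedModType R)
    (A : set V) (f : V -> W) : Prop :=
  forall p, A p -> exists U : set V, exists F : V -> W,
    [/\ open U, U p, smooth U F & forall q, A q -> U q -> f q = F q].

Definition partial (R : realType) (n : nat) (W : normedModType R) (i : 'I_n)
    (f : 'rV[R]_n -> W) (p : 'rV[R]_n) : W := 'D_(delta_mx 0 i) f p.

(* phi restricted to U is an injective immersion and a homeomorphism onto a
   relatively open subset of M. *)
Definition parametrizes (R : realType) (k n : nat) (U : set 'rV[R]_k)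
    (phi : 'rV[R]_k -> 'rV[R]_n) (M : set 'rV[R]_n) : Prop :=
  [/\ open U, smooth U phi,
      (forall y, U y -> injective ('d phi y)),
      {in U &, injective phi} &
      forall O : set 'rV[R]_k, open O -> O `<=` U ->
        exists V : set 'rV[R]_n, open V /\ phi @` O = M `&` V].

(* Embedded k-dimensional submanifold of R^n (not necessarily connected). *)
Definition submanifold (R : realType) (n k : nat) (M : set 'rV[R]_n) : Prop :=
  forall p, M p -> exists U : set 'rV[R]_k, exists phi : 'rV[R]_k -> 'rV[R]_n,
    parametrizes U phi M /\ (phi @` U) p.

(* c is a smooth curve in A with c 0 = p. *)
Definition curve_at (R : realType) (n : nat) (A : set 'rV[R]_n)
    (p : 'rV[R]_n) (c : R -> 'rV[R]_n) : Prop :=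
  c 0 = p /\ exists e : R, [/\ 0 < e, smooth (ball (0 : R^o) e) (c : R^o -> _) &
    forall h, ball (0 : R^o) e h -> A (c h)].

Definition tangent (R : realType) (n : nat) (A : set 'rV[R]_n)
    (p : 'rV[R]_n) : set 'rV[R]_n :=
  [set X | exists c, curve_at A p c /\ X = derive1 c 0].

Definition ip (R : realType) (n : nat) (g : 'rV[R]_n -> 'M[R]_n)
    (p X Y : 'rV[R]_n) : R := (X *m g p *m Y^T) 0 0.

(* g restricted to the tangent spaces of B is a Riemannian metric on B.  The
   metric induced on a submanifold M of (R^n, g) is thus g itself. *)
Definition riemannian (R : realType) (n : nat) (B : set 'rV[R]_n)
    (g : 'rV[R]_n -> 'M[R]_n) : Prop :=
  smooth_on B g /\
  forall p, B p ->
    (forall X Y, tangent B p X -> tangent B p Y -> ip g p X Y = ip g p Y X) /\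
    (forall X, tangent B p X -> X != 0 -> 0 < ip g p X X).

(* Gamma^k_ij of the Levi-Civita connection of g on R^n. *)
Definition christoffel (R : realType) (n : nat) (g : 'rV[R]_n -> 'M[R]_n)
    (p : 'rV[R]_n) (k i j : 'I_n) : R :=
  2^-1 * \sum_(l < n) invmx (g p) k l *
    (partial i (fun q => g q j l : R^o) p
     + partial j (fun q => g q i l : R^o) p
     - partial l (fun q => g q i j : R^o) p).

(* k-th component of (nabla_i J) d_j = nabla_i (J d_j) - J (nabla_i d_j),
   where J d_j = \sum_k J j k d_k. *)
Definition nablaJ (R : realType) (n : nat) (g J : 'rV[R]_n -> 'M[R]_n)
    (p : 'rV[R]_n) (i j k : 'I_n) : R :=
  partial i (fun q => J q j k : R^o) p
  + \sum_(l < n) J p j l * christoffel g p k i l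
  - \sum_(l < n) christoffel g p l i j * J p l k.

(* Kaehler structure on the manifold R^n: an almost Hermitian structure whose
   complex structure is parallel. *)
Definition kaehler (R : realType) (n : nat) (g J : 'rV[R]_n -> 'M[R]_n) : Prop :=
  [/\ riemannian [set: 'rV[R]_n] g,
      smooth [set: 'rV[R]_n] J,
      (forall p, J p *m J p = - 1%:M),
      (forall p X Y, ip g p (X *m J p) (Y *m J p) = ip g p X Y) &
      forall p i j k, nablaJ g J p i j k = 0].

(* Smooth rank-r distribution on M, locally spanned by the rows of a smooth
   matrix field. *)
Definition smooth_distribution (R : realType) (n r : nat) (M : set 'rV[R]_n)
    (D : 'rV[R]_n -> set 'rV[R]_n) : Prop :=
  forall p, M p -> D p `<=` tangent M p /\
    exists V : set 'rV[R]_n, exists F : 'rV[R]_n -> 'M[R]_(r, n),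
      [/\ open V, V p, smooth V F &
          forall q, M q -> V q ->
            row_free (F q) /\ D q = [set X : 'rV[R]_n | (X <= F q)%MS]].

Definition integral_manifold (R : realType) (n : nat) (M : set 'rV[R]_n)
    (D : 'rV[R]_n -> set 'rV[R]_n) (N : set 'rV[R]_n) : Prop :=
  [/\ N !=set0, N `<=` M, (exists k, submanifold k N) &
      forall p, N p -> tangent N p = D p].

Definition integrable_distribution (R : realType) (n : nat)
    (M : set 'rV[R]_n) (D : 'rV[R]_n -> set 'rV[R]_n) : Prop :=
  forall p, M p -> exists N, integral_manifold M D N /\ N p.

Definition angle (R : realType) (n : nat) (g : 'rV[R]_n -> 'M[R]_n)
    (p X Y : 'rV[R]_n) : R :=
  acos (ip g p X Y / (Num.sqrt (ip g p X X) * Num.sqrt (ip g p Y Y))).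

(* Angle between X != 0 and the linear subspace W != 0: the least angle
   between X and a nonzero vector of W. *)
Definition angle_to (R : realType) (n : nat) (g : 'rV[R]_n -> 'M[R]_n)
    (p X : 'rV[R]_n) (W : set 'rV[R]_n) : R :=
  inf [set angle g p X Y | Y in [set Y | W Y /\ Y != 0]].

Definition holomorphic_distribution (R : realType) (n : nat)
    (J : 'rV[R]_n -> 'M[R]_n) (M : set 'rV[R]_n)
    (D : 'rV[R]_n -> set 'rV[R]_n) : Prop :=
  forall p, M p -> [set X *m J p | X in D p] = D p.

Definition pointwise_slant_distribution (R : realType) (n : nat)
    (g J : 'rV[R]_n -> 'M[R]_n) (M : set 'rV[R]_n)
    (D : 'rV[R]_n -> set 'rV[R]_n) (theta : 'rV[R]_n -> R) : Prop :=
  forall p, M p -> forall X, D p X -> X != 0 ->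
    angle_to g p (X *m J p) (D p) = theta p.

Definition pointwise_semi_slant (R : realType) (n : nat)
    (g J : 'rV[R]_n -> 'M[R]_n) (M : set 'rV[R]_n)
    (DT Dth : 'rV[R]_n -> set 'rV[R]_n) (theta : 'rV[R]_n -> R) : Prop :=
  (exists k, submanifold k M) /\
  (exists r, smooth_distribution r M DT) /\ (exists r, smooth_distribution r M Dth) /\
  (forall p, M p ->
     tangent M p = [set X | exists X1 X2, [/\ DT p X1, Dth p X2 & X = X1 + X2]] /\
     (forall X Y, DT p X -> Dth p Y -> ip g p X Y = 0)) /\
  holomorphic_distribution J M DT /\
  pointwise_slant_distribution g J M Dth theta.

Definition holomorphic_submanifold (R : realType) (n : nat)
    (J : 'rV[R]_n -> 'M[R]_n) (N : set 'rV[R]_n) : Prop :=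
  (exists k, submanifold k N) /\
  forall p, N p -> forall X, tangent N p X -> tangent N p (X *m J p).

Definition proper_pointwise_slant_submanifold (R : realType) (n : nat)
    (g J : 'rV[R]_n -> 'M[R]_n) (N : set 'rV[R]_n) : Prop :=
  (exists k, submanifold k N) /\
  exists theta : 'rV[R]_n -> R,
    pointwise_slant_distribution g J N (tangent N) theta /\
    forall p, N p -> theta p != pi / 2.

Definition product_manifold (R : realType) (m n : nat)
    (B : set 'rV[R]_m) (F : set 'rV[R]_n) : set 'rV[R]_(m + n) :=
  [set z | B (lsubmx z) /\ F (rsubmx z)].

(* pi^* gB + (f o pi)^2 eta^* gF, with pi = lsubmx and eta = rsubmx. *)
Definition warped_metric (R : realType) (m n : nat)
    (gB : 'rV[R]_m -> 'M[R]_m) (gF : 'rV[R]_n -> 'M[R]_n) (f : 'rV[R]_m -> R)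
    (z : 'rV[R]_(m + n)) : 'M[R]_(m + n) :=
  block_mx (gB (lsubmx z)) 0 0 ((f (lsubmx z)) ^+ 2 *: gF (rsubmx z)).

(* Isometry of (A, gA) onto (M, gM); the differential of Psi maps the velocity
   of a curve c to that of Psi \o c. *)
Definition riemannian_isometry (R : realType) (m n : nat)
    (A : set 'rV[R]_m) (gA : 'rV[R]_m -> 'M[R]_m)
    (M : set 'rV[R]_n) (gM : 'rV[R]_n -> 'M[R]_n)
    (Psi : 'rV[R]_m -> 'rV[R]_n) : Prop :=
  [/\ smooth_on A Psi,
      Psi @` A = M,
      (exists Psi' : 'rV[R]_n -> 'rV[R]_m,
         smooth_on M Psi' /\ forall z, A z -> Psi' (Psi z) = z) &
      forall z c1 c2, A z -> curve_at A z c1 -> curve_at A z c2 ->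
        ip gM (Psi z) (derive1 (Psi \o c1) 0) (derive1 (Psi \o c2) 0) =
        ip gA z (derive1 c1 0) (derive1 c2 0)].

(* Psi identifies the warped product (B, gB) x_f (F, gF) with M, the slices
   B x {q} and {p} x F corresponding to integral manifolds of D1 and D2. *)
Definition warped_product_along (R : realType) (m l n : nat)
    (M : set 'rV[R]_n) (g : 'rV[R]_n -> 'M[R]_n)
    (D1 D2 : 'rV[R]_n -> set 'rV[R]_n)
    (B : set 'rV[R]_m) (gB : 'rV[R]_m -> 'M[R]_m)
    (F : set 'rV[R]_l) (gF : 'rV[R]_l -> 'M[R]_l)
    (f : 'rV[R]_m -> R) (Psi : 'rV[R]_(m + l) -> 'rV[R]_n) : Prop :=
  [/\ riemannian B gB /\ riemannian F gF,
      smooth_on B (f : _ -> R^o) /\ (forall p, B p -> 0 < f p),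
      riemannian_isometry (product_manifold B F) (warped_metric gB gF f) M g Psi,
      (forall q, F q -> integral_manifold M D1 [set Psi (row_mx p q) | p in B]) &
      (forall p, B p -> integral_manifold M D2 [set Psi (row_mx p q) | q in F])].

Definition nonconstant_on (R : realType) (n : nat) (B : set 'rV[R]_n)
    (f : 'rV[R]_n -> R) : Prop :=
  exists p q, [/\ B p, B q & f p != f q].

(* M is a non-trivial warped product pointwise semi-slant submanifold
   MT x_f Mth of (R^n, g, J), where MT and Mth carry the metrics gT and gth. *)
Definition warped_product_semi_slant (R : realType) (n : nat)
    (g J : 'rV[R]_n -> 'M[R]_n) (M : set 'rV[R]_n)
    (DT Dth : 'rV[R]_n -> set 'rV[R]_n) (theta : 'rV[R]_n -> R)
    (MT : set 'rV[R]_n) (gT : 'rV[R]_n -> 'M[R]_n)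
    (Mth : set 'rV[R]_n) (gth : 'rV[R]_n -> 'M[R]_n)
    (f : 'rV[R]_n -> R) (Psi : 'rV[R]_(n + n) -> 'rV[R]_n) : Prop :=
  [/\ pointwise_semi_slant g J M DT Dth theta,
      integral_manifold M DT MT /\ holomorphic_submanifold J MT,
      integral_manifold M Dth Mth /\ proper_pointwise_slant_submanifold g J Mth,
      warped_product_along M g DT Dth MT gT Mth gth f Psi &
      nonconstant_on MT f].

Definition euclidean_metric (R : realType) (n : nat) : 'rV[R]_n -> 'M[R]_n :=
  fun _ => 1%:M.

(* Zero-based: e_(2i) |-> e_(2i+1) and e_(2i+1) |-> - e_(2i). *)
Definition canonical_J (R : realType) : 'rV[R]_10 -> 'M[R]_10 :=
  fun _ => \matrix_(i < 10, j < 10)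
    if odd i then - ((j.+1 == i :> nat)%:R) else (j == i.+1 :> nat)%:R.

(* The coordinates (t, s, u, v) are the entries 0, 1, 2, 3 of y : 'rV[R]_4. *)
Definition ex_domain (R : realType) : set 'rV[R]_4 :=
  [set y | [/\ y 0 0 != 0 /\ y 0 0 != 1, y 0 1 != 0 /\ y 0 1 != 1,
               0 < y 0 2 < pi / 2 & 0 < y 0 3 < pi / 2]].

Definition ex_param (R : realType) (y : 'rV[R]_4) : 'rV[R]_10 :=
  let t := y 0 0 in let s := y 0 1 in let u := y 0 2 in let v := y 0 3 in
  \row_(i < 10) nth 0
    [:: t * cos u; s * cos u; t * cos v; s * cos v;
        t * sin u; s * sin u; t * sin v; s * sin v; u; v] i.

Definition ex_M (R : realType) : set 'rV[R]_10 := @ex_param R @` @ex_domain R.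

(* The span of the i-th and j-th coordinate fields, as a distribution on
   ex_M (ex_param is injective on ex_domain). *)
Definition ex_span (R : realType) (i j : 'I_4) (p : 'rV[R]_10) : set 'rV[R]_10 :=
  [set X | exists y, [/\ ex_domain y, ex_param y = p &
     exists a b : R,
       X = a *: partial i (@ex_param R) y + b *: partial j (@ex_param R) y]].

Definition ex_DT (R : realType) : 'rV[R]_10 -> set 'rV[R]_10 := @ex_span R 0 1.
Definition ex_Dth (R : realType) : 'rV[R]_10 -> set 'rV[R]_10 := @ex_span R 2 3.

(* The leaves of ex_DT and ex_Dth through ex_param y0. *)
Definition ex_MT (R : realType) (y0 : 'rV[R]_4) : set 'rV[R]_10 :=
  [set ex_param y | y in [set y | [/\ ex_domain y, y 0 2 = y0 0 2 & y 0 3 = y0 0 3]]].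
Definition ex_Mth (R : realType) (y0 : 'rV[R]_4) : set 'rV[R]_10 :=
  [set ex_param y | y in [set y | [/\ ex_domain y, y 0 0 = y0 0 0 & y 0 1 = y0 0 1]]].

(* t^2 + s^2 + 1 *)
Definition ex_w (R : realType) (y : 'rV[R]_4) : R := y 0 0 ^+ 2 + y 0 1 ^+ 2 + 1.

(* The metric du^2 + dv^2 on the leaf ex_Mth y0: the metric induced there is
   (t0^2 + s0^2 + 1) (du^2 + dv^2).  This normalization makes the warping
   function equal to sqrt (t^2 + s^2 + 1). *)
Definition ex_gth (R : realType) (y0 : 'rV[R]_4) : 'rV[R]_10 -> 'M[R]_10 :=
  fun p => (ex_w y0)^-1 *: euclidean_metric p.

(* Main.v *)
Require Import Defs.
From HB Require Import structures.
From mathcomp Require Import all_boot all_order all_algebra.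
From mathcomp Require Import all_classical all_reals all_analysis.
From mathcomp Require Import ring lra.

Set Implicit Arguments.
Unset Strict Implicit.
Unset Printing Implicit Defensive.
Import Order.TTheory GRing.Theory Num.Theory.
Import numFieldNormedType.Exports.
Local Open Scope classical_set_scope.
Local Open Scope ring_scope.

(* The map ex_param has a globally smooth left inverse ex_coords: since
   t = x_1 cos u + x_5 sin u, s = x_2 cos u + x_6 sin u, u = x_9, v = x_10, no
   division is needed.  Hence M and all its coordinate slices are embedded
   submanifolds, and every curve in them is ex_param composed with a curve of
   coordinates, which computes all tangent spaces.  What remains is linear
   algebra in the frame d_t, d_s, d_u, d_v: J d_t = d_s, the Gram matrix is
   diag (2, 2, w, w) with w = t^2 + s^2 + 1, and <J d_u, d_v> = 1, so that the
   projection of J X to D^theta has length |X| / w. *)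

(** Three features of the definitions shape the proof. [smooth] asks for iterated directional
    derivatives of every order, and at order k the chain rule is needed in two easy cases only: an
    affine inner map, or an outer map assembled from sums, products, sine, cosine and square root.
    The entries of [ex_param] and [ex_coords] are of the second kind. Frames, the warping function
    and the product map are therefore written on the whole ambient space through [ex_coords], and
    [smooth_on] always follows from a global extension. Next, the range of (t, s) is disconnected,
    so the leaves are too; but [ex_domain] constrains (t, s) and (u, v) separately, so the (t, s) of
    one point may be combined with the (u, v) of another, and the product decomposition is global.
    Finally, the angle to a subspace is an infimum of angles: the slant function is found by
    exhibiting a minimiser and bounding all other cosines with the Cauchy-Schwarz inequality, and
    the orthogonal projection is never formed. *)

Section smoothness.
Context {R : realType}.
Implicit Types U V W : normedModType R.

(** * Closure properties of C^k and smooth maps *)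

Lemma CkS V W k (U : set V) (f : V -> W) : Ck k.+1 U f -> Ck k U f.
Proof.
elim: k f => [|k IH] f [df Df]; first by move=> x /df/differentiable_continuous.
by split=> // v; exact: IH (Df v).
Qed.

Lemma Ck_subset V W k (U U' : set V) (f : V -> W) :
  U' `<=` U -> Ck k U f -> Ck k U' f.
Proof.
move=> sub; elim: k f => [|k IH] f /= => [cf x /sub /cf//|[df Df]].
by split=> [x /sub /df//|v]; exact: IH.
Qed.

Lemma smooth_subset V W (U : set V) (f : V -> W) :
  smooth [set: V] f -> smooth U f.
Proof. by move=> sf k; exact: Ck_subset (sf k). Qed.

Lemma smooth_smooth_on V W (A : set V) (f : V -> W) :
  smooth [set: V] f -> smooth_on A f.
Proof. by move=> sf p _; exists [set: V], f; split=> //; exact: openT. Qed.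

Lemma smooth_differentiable V W (U : set V) (f : V -> W) x :
  U x -> smooth U f -> differentiable f x.
Proof. by move=> Ux /(_ 1%N)[/(_ x Ux)]. Qed.

(** Lets an induction on the order continue with a closed formula [df] in place of the raw
    derivative. The two are exchanged as functions, which is why the formula is required at every
    point and not only on [U]. *)
Lemma Ck_succ V W k (U : set V) (f : V -> W) (df : V -> V -> W) :
  (forall x, U x -> differentiable f x) -> (forall v x, 'D_v f x = df v x) ->
  (forall v, Ck k U (df v)) -> Ck k.+1 U f.
Proof.
move=> dif Df Ckdf; split=> // v.
by rewrite (_ : (fun x => 'D_v f x) = df v)//; apply/funext.
Qed.

Lemma Ck_derive V W k (U : set V) (f : V -> W) : Ck k.+1 U f ->
  (forall x, U x -> differentiable f x) /\ (forall v, Ck k U ('D_v f)).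
Proof. by []. Qed.

Lemma Ck_cst V W k (U : set V) (a : W) : Ck k U (fun=> a).
Proof.
elim: k a => [|k IH] a; first by move=> x _; exact: cvg_cst.
apply: (@Ck_succ _ _ _ _ _ (fun _ _ => 0)) => [x _|v x|v].
- exact: differentiable_cst.
- exact: derive_cst.
- exact: IH.
Qed.

Lemma smooth_cst V W (U : set V) (a : W) : smooth U (fun=> a).
Proof. by move=> k; exact: Ck_cst. Qed.

Lemma smooth_linear V W (l : {linear V -> W}) :
  continuous l -> smooth [set: V] l.
Proof.
move=> cl [|k]; first by move=> x _; exact: cl.
apply: (Ck_succ (df := fun v _ => l v)) => [x _|v x|v].
- exact: linear_differentiable.
- by rewrite deriveE ?diff_lin//; exact: linear_differentiable.
- exact: Ck_cst.
Qed.

Lemma smooth_id V : smooth [set: V] id.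
Proof. by apply: (@smooth_linear V V idfun) => x; exact: cvg_id. Qed.

Lemma CkD V W k (f g : V -> W) : Ck k [set: V] f -> Ck k [set: V] g ->
  Ck k [set: V] (fun x => f x + g x).
Proof.
elim: k f g => [|k IH] f g.
  by move=> cf cg x _; apply: cvgD; [exact: cf|exact: cg].
move=> /Ck_derive[df Df] /Ck_derive[dg Dg].
apply: (Ck_succ (df := fun v x => 'D_v f x + 'D_v g x)) => [x _|v x|v].
- by apply: differentiableD; [exact: df|exact: dg].
- by apply: deriveD; apply: diff_derivable; [exact: df|exact: dg].
- exact: IH.
Qed.

Lemma CkM V k (f g : V -> R^o) : Ck k [set: V] f -> Ck k [set: V] g ->
  Ck k [set: V] ((fun x => f x * g x) : V -> R^o).
Proof.
elim: k f g => [|k IH] f g.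
  by move=> cf cg x _; apply: cvgM; [exact: cf|exact: cg].
(* The Leibniz formula multiplies a derivative by an undifferentiated factor, so [f] and [g] are
   also kept at order k. *)
move=> fk gk; have [f' g'] := (CkS fk, CkS gk).
move: fk gk => /Ck_derive[df Df] /Ck_derive[dg Dg]; 
apply: (Ck_succ (df := fun v x => f x * 'D_v g x + g x * 'D_v f x)) => [x _|v x|v].
- by apply: differentiableM; [exact: df|exact: dg].
- by apply: deriveM; apply: diff_derivable; [exact: df|exact: dg].
- by apply: CkD; apply: IH.
Qed.

Lemma CkN V k (f : V -> R^o) : Ck k [set: V] f ->
  Ck k [set: V] ((fun x => - f x) : V -> R^o).
Proof.
move=> fk; rewrite (_ : (fun x => - f x) = fun x => (-1) * f x).
  by apply: CkM => //; exact: Ck_cst.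
by apply/funext => x; rewrite mulN1r.
Qed.

Lemma derive_comp_scalar V (h : R -> R) (f : V -> R^o) x v dh :
  is_derive (f x : R) 1 h dh -> differentiable f x ->
  differentiable ((h \o f) : V -> R^o) x /\
  'D_v ((h \o f) : V -> R^o) x = dh * 'D_v f x.
Proof.
move=> [hh <-] df; have dh' : differentiable h (f x) by apply/derivable1_diffP.
have dc : differentiable ((h \o f) : V -> R^o) x by exact: differentiable_comp.
split=> //; rewrite !deriveE// diff_comp//=.
(* A linear map on the line is multiplication by its value at 1. *)
by rewrite -[X in 'd h _ X]mulr1 [LHS]linearZ/= mulrC.
Qed.

(** Each function is, up to sign, the derivative of the other, so neither induction closes alone. *)
Lemma Ck_cos_sin V k (f : V -> R^o) : Ck k [set: V] f ->
  Ck k [set: V] ((fun x => cos (f x)) : V -> R^o) /\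
  Ck k [set: V] ((fun x => sin (f x)) : V -> R^o).
Proof.
elim: k f => [|k IH] f.
  move=> cf; split=> x _.
    by apply: continuous_comp; [exact: cf|exact: continuous_cos].
  by apply: continuous_comp; [exact: cf|exact: continuous_sin].
move=> fk; have [ck sk] := IH _ (CkS fk); move: fk => /Ck_derive[df Df].
have C v x := @derive_comp_scalar V cos f x v _ (is_derive_cos _) (df x I).
have S v x := @derive_comp_scalar V sin f x v _ (is_derive_sin _) (df x I).
split.
  apply: (Ck_succ (df := fun v x => - sin (f x) * 'D_v f x)) => [x _|v x|v].
  - by case: (C 0 x).
  - by case: (C v x).
  - by apply: CkM => //; exact: CkN.
apply: (Ck_succ (df := fun v x => cos (f x) * 'D_v f x)) => [x _|v x|v].
- by case: (S 0 x).
- by case: (S v x).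
- exact: CkM.
Qed.

(* The two functions are treated together because the derivatives of each are
   polynomial in the reciprocal one. *)
Lemma Ck_sqrt V k (f : V -> R^o) : (forall x, 0 < f x) -> Ck k [set: V] f ->
  Ck k [set: V] ((fun x => Num.sqrt (f x)) : V -> R^o) /\
  Ck k [set: V] ((fun x => (Num.sqrt (f x))^-1) : V -> R^o).
Proof.
move=> f0; have s0 x : Num.sqrt (f x : R) != 0 by rewrite gt_eqF// sqrtr_gt0.
elim: k => [|k IH].
  move=> cf; have cs : Ck 0 [set: V] ((fun x => Num.sqrt (f x)) : V -> R^o).
    by move=> x _; apply: continuous_comp; [exact: cf|exact: sqrt_continuous].
  by split=> // x _; apply: cvgV => //; exact: cs.
move=> fk; have [ck sk] := IH (CkS fk); move: fk => /Ck_derive[df Df].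
have S v x := @derive_comp_scalar V Num.sqrt f x v _ (is_derive1_sqrt (f0 x)) (df x I).
have D v : Ck k [set: V] ((fun x => 2^-1 * (Num.sqrt (f x))^-1 * 'D_v f x) : V -> R^o).
  by apply: CkM => //; apply: CkM => //; exact: Ck_cst.
split.
  apply: (Ck_succ (df := fun v x => 2^-1 * (Num.sqrt (f x))^-1 * 'D_v f x)) => // [x _|v x].
    by case: (S 0 x).
  by case: (S v x) => _ ->; rewrite invfM.
apply: (Ck_succ (df := fun v x => - ((Num.sqrt (f x))^-1 * (Num.sqrt (f x))^-1 *
    (2^-1 * (Num.sqrt (f x))^-1 * 'D_v f x)))) => [x _|v x|v].
- by apply: differentiableV => //; case: (S 0 x).
- case: (S v x) => dS eS.
  rewrite (@deriveV _ _ (fun x => Num.sqrt (f x) : R^o))//.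
    by rewrite eS !invfM /GRing.scale/= mulNr.
  exact: diff_derivable.
- by apply: CkN; apply: CkM => //; exact: CkM.
Qed.

Lemma smoothD V W (f g : V -> W) : smooth [set: V] f -> smooth [set: V] g ->
  smooth [set: V] (fun x => f x + g x).
Proof. by move=> sf sg k; exact: CkD. Qed.

Lemma smoothM V (f g : V -> R^o) : smooth [set: V] f -> smooth [set: V] g ->
  smooth [set: V] ((fun x => f x * g x) : V -> R^o).
Proof. by move=> sf sg k; exact: CkM. Qed.

Lemma smoothN V (f : V -> R^o) : smooth [set: V] f ->
  smooth [set: V] ((fun x => - f x) : V -> R^o).
Proof. by move=> sf k; exact: CkN. Qed.

Lemma smooth_cos V (f : V -> R^o) : smooth [set: V] f ->
  smooth [set: V] ((fun x => cos (f x)) : V -> R^o).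
Proof. by move=> sf k; case: (Ck_cos_sin (sf k)). Qed.

Lemma smooth_sin V (f : V -> R^o) : smooth [set: V] f ->
  smooth [set: V] ((fun x => sin (f x)) : V -> R^o).
Proof. by move=> sf k; case: (Ck_cos_sin (sf k)). Qed.

Lemma smooth_sqrt V (f : V -> R^o) : (forall x, 0 < f x) ->
  smooth [set: V] f -> smooth [set: V] ((fun x => Num.sqrt (f x)) : V -> R^o).
Proof. by move=> f0 sf k; case: (Ck_sqrt f0 (sf k)). Qed.

Lemma differentiable_mx V m n (F : V -> 'M[R]_(m, n)) x :
  (forall i j, differentiable ((fun x => F x i j) : V -> R^o) x) ->
  differentiable F x.
Proof.
move=> dF; rewrite (_ : F = fun x =>
  \sum_(i < m) \sum_(j < n) (F x i j) *: (delta_mx i j : 'M[R]_(m, n))).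
  rewrite (_ : (fun x => _) = \sum_(i < m) \sum_(j < n)
    (fun x => (F x i j) *: (delta_mx i j : 'M[R]_(m, n)))).
    apply: differentiable_sum => i; apply: differentiable_sum => j.
    exact: differentiableZl.
  by apply/funext => y; rewrite fct_sumE; apply: eq_bigr => i _; rewrite fct_sumE.
by apply/funext => y; exact: matrix_sum_delta.
Qed.

Lemma derive_coord V m n (F : V -> 'M[R]_(m, n)) x v i j : differentiable F x ->
  'D_v F x i j = 'D_v ((fun x => F x i j) : V -> R^o) x.
Proof. by move=> dF; rewrite derive_mx ?mxE//; exact: diff_derivable. Qed.

Lemma smooth_mx V m n (F : V -> 'M[R]_(m, n)) :
  (forall i j, smooth [set: V] ((fun x => F x i j) : V -> R^o)) ->
  smooth [set: V] F.
Proof.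
(* One extra order is kept on the entries: it makes [F] differentiable, which gives continuity in
   the base case and allows differentiation entry by entry in the inductive step. *)
move=> sF k; have {}sF i j : Ck k.+1 [set: V] ((fun x => F x i j) : V -> R^o).
  exact: sF.
elim: k F sF => [|k IH] F sF.
  move=> x _; apply: differentiable_continuous; apply: differentiable_mx => i j.
  by case: (sF i j) => + _; apply.
have dF x : differentiable F x.
  by apply: differentiable_mx => i j; case: (sF i j) => + _; apply.
split=> // v; apply: IH => i j.
rewrite (_ : (fun x => 'D_v F x i j) = 'D_v ((fun x => F x i j) : V -> R^o)).
  by case: (sF i j) => _; apply.
by apply/funext => x; rewrite derive_coord.
Qed.

Lemma smooth_mx_coord V m n (F : V -> 'M[R]_(m, n)) i j :
  smooth [set: V] F -> smooth [set: V] ((fun x => F x i j) : V -> R^o).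
Proof.
move=> sF k; move: (sF k) => {sF}; elim: k F => [|k IH] F.
  move=> cF x _; apply: (@continuous_comp _ _ _ F (fun M => M i j)); first exact: cF.
  exact: coord_continuous.
move=> /Ck_derive[dF DF].
apply: (Ck_succ (df := fun v x => 'D_v F x i j)) => [x _|v x|v].
- apply: (@differentiable_comp _ _ _ _ F (fun M => M i j : R^o)); first exact: dF.
  exact: differentiable_coord.
- by rewrite derive_coord//; exact: dF.
- exact: IH.
Qed.

Lemma smooth_row_mx V m n (F : V -> 'rV[R]_m) (G : V -> 'rV[R]_n) :
  smooth [set: V] F -> smooth [set: V] G ->
  smooth [set: V] (fun x => row_mx (F x) (G x)).
Proof.
move=> sF sG; apply: smooth_mx => i j; under eq_fun do rewrite mxE.
by case: (fintype.split j) => l; exact: smooth_mx_coord.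
Qed.

Lemma smooth_coord m n i j :
  smooth [set: 'M[R]_(m, n)] ((fun M => M i j) : _ -> R^o).
Proof.
have @f : {linear 'M[R]_(m, n) -> R^o}.
  by exists (fun N : 'M[R]_(_, _) => N i j); do 2![eexists]; do ?[constructor];
     rewrite ?mxE// => ? *; rewrite ?mxE//; move=> ?; rewrite !mxE.
by apply: (@smooth_linear _ _ f); exact: coord_continuous.
Qed.

Lemma derive_comp U V W (f : V -> W) (g : U -> V) x v :
  differentiable g x -> differentiable f (g x) ->
  'D_v (f \o g) x = 'D_('D_v g x) f (g x).
Proof.
move=> dg df; rewrite !deriveE//; last exact: differentiable_comp.
by rewrite diff_comp.
Qed.

(** Since [dg v] does not depend on the point, the derivative of [f \o g] along [v] is
    ['D_(dg v) f \o g], a composite with the same inner map. The induction closes without any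
    product term. *)
Lemma smooth_comp_affine U V W (f : V -> W) (g : U -> V) (dg : U -> V) :
  (forall x, differentiable g x) -> (forall x v, 'D_v g x = dg v) ->
  smooth [set: V] f -> smooth [set: U] (f \o g).
Proof.
move=> gdif gD sf k; move: (sf k) => {sf}; elim: k f => [|k IH] f.
  move=> cf x _; apply: continuous_comp; last exact: cf.
  exact: differentiable_continuous.
move=> /Ck_derive[df Df].
apply: (Ck_succ (df := fun v => 'D_(dg v) f \o g)) => [x _|v x|v].
- by apply: differentiable_comp => //; exact: df.
- by rewrite derive_comp ?gD//; exact: df.
- exact: IH.
Qed.

End smoothness.

(** * Submanifolds whose parametrization has a global left inverse *)

Section retractions.
Context {R : realType}.

Lemma curve_at_near n (A : set 'rV[R]_n) p c : curve_at A p c ->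
  [/\ c 0 = p, differentiable (c : R^o -> 'rV[R]_n) 0 &
      \forall h \near (0 : R^o), A (c h)].
Proof.
move=> [c0 [e [e0 sc Ac]]]; split=> //.
  by apply: smooth_differentiable sc; exact: ballxx.
by apply/nbhs_ballP; exists e.
Qed.

Variables (k n : nat) (U : set 'rV[R]_k).
Variables (phi : 'rV[R]_k -> 'rV[R]_n) (psi : 'rV[R]_n -> 'rV[R]_k).
Hypothesis phi_smooth : smooth [set: 'rV[R]_k] phi.
Hypothesis psi_diff : forall x, differentiable psi x.
Hypothesis phiK : cancel phi psi.

Let phi_diff y : differentiable phi y.
Proof. exact: smooth_differentiable phi_smooth. Qed.

Lemma parametrizes_retract : open U -> parametrizes U phi (phi @` U).
Proof.
move=> oU; split=> //.
- exact: smooth_subset.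
- move=> y _; apply: (can_inj (g := 'd psi (phi y))) => v.
  have := diff_comp (phi_diff y) (psi_diff (phi y)).
  rewrite (_ : psi \o phi = id); last by apply/funext => z /=; exact: phiK.
  by rewrite diff_val => /(congr1 (@^~ v)).
- by move=> y z _ _; exact: can_inj phiK y z.
move=> O oO OU; exists (psi @^-1` O); split.
  by apply: open_comp => // x _; exact: differentiable_continuous.
rewrite predeqE => x; split=> [[y Oy <-]|[[y Uy <-]]]; last first.
  by rewrite /preimage/= phiK; exists y.
by split; [exists y => //; exact: OU|rewrite /preimage/= phiK].
Qed.

(* A curve in the image of phi is phi composed with the curve psi \o c. *)
Lemma derive1_retract (A : set 'rV[R]_k) (c : R -> 'rV[R]_n) :
  differentiable (c : R^o -> 'rV[R]_n) 0 ->
  (\forall h \near (0 : R^o), (phi @` A) (c h)) ->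
  differentiable (psi \o c : R^o -> 'rV[R]_k) 0 /\
  derive1 c 0 = 'D_(derive1 (psi \o c) 0) phi (psi (c 0)).
Proof.
move=> dc Ac; have dpc : differentiable (psi \o c : R^o -> 'rV[R]_k) 0.
  exact: (@differentiable_comp _ R^o).
split=> //; rewrite deriveE// !derive1E.
rewrite (@near_eq_derive _ R^o _ c (phi \o (psi \o c))).
  rewrite !deriveE//; last exact: (@differentiable_comp _ R^o).
  by rewrite (@diff_comp _ R^o).
by apply: filterS Ac => h [y _ yE]; rewrite /= -yE phiK.
Qed.

Lemma tangent_retract y : open U -> U y ->
  tangent (phi @` U) (phi y) = [set 'D_Y phi y | Y in [set: 'rV[R]_k]].
Proof.
move=> oU Uy; rewrite predeqE => X; split.
  move=> [c [/curve_at_near[c0 dc Ac] ->]]; exists (derive1 (psi \o c) 0) => //.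
  by have [_ ->] := derive1_retract dc Ac; rewrite c0 phiK.
(* Every direction [Y] is realised by the image of a straight segment, which stays in the open set
   [U] for small h. *)
move=> [Y _ <-]; exists (fun h : R => phi (h *: Y + y)); split; last first.
  (* Both sides are the limit of one and the same difference quotient. *)
  by rewrite /derive1; under [in RHS]eq_fun do rewrite addr0 scale0r add0r.
split; first by rewrite scale0r add0r.
have : \forall h \near (0 : R^o), U (h *: Y + y).
  have : {for (0 : R^o), continuous (fun h : R^o => h *: Y + y)}.
    by apply: cvgD; [exact: scalel_continuous|exact: cvg_cst].
  by apply; rewrite /= scale0r add0r; exact: open_nbhs_nbhs.
move=> /nbhs_ballP[e /= e0 He]; exists e; split=> //.
  apply: smooth_subset.
  have dl x : is_diff x (fun h : R^o => h *: Y + y) (fun h : R^o => h *: Y).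
    rewrite -[X in is_diff _ _ X]addr0.
    have := @is_diff_cst R R^o _ y x; have := @is_diff_scalel R _ x Y.
    by move=> ? ?; exact: is_diffD.
  apply: (@smooth_comp_affine _ R^o _ _ phi (fun h : R^o => h *: Y + y)
    (fun h : R^o => h *: Y)) => // x v.
  by rewrite deriveE// diff_val.
by move=> h /He Uh; exists (h *: Y + y).
Qed.

End retractions.

(** * Affine maps of row vectors *)

Section affine_maps.
Context {R : realType}.

Lemma smooth_sum (V : normedModType R) I (r : seq I) (F : I -> V -> R^o) :
  (forall i, smooth [set: V] (F i)) ->
  smooth [set: V] ((fun x => \sum_(i <- r) F i x) : V -> R^o).
Proof.
move=> sF; elim: r => [|i r IH].
  by under eq_fun do rewrite big_nil; exact: smooth_cst.
by under eq_fun do rewrite big_cons; exact: smoothD.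
Qed.

Lemma smooth_affine m n (A : 'M[R]_(m, n)) (b : 'rV[R]_n) :
  smooth [set: 'rV[R]_m] (fun x => x *m A + b).
Proof.
apply: smooth_mx => i j.
under eq_fun do rewrite !mxE.
apply: smoothD; last exact: smooth_cst.
by apply: smooth_sum => l; apply: smoothM; [exact: smooth_coord|exact: smooth_cst].
Qed.

Lemma derive_affine m n (A : 'M[R]_(m, n)) (b : 'rV[R]_n) x v :
  'D_v (fun x : 'rV[R]_m => x *m A + b) x = v *m A.
Proof.
rewrite /derive; apply: lim_near_cst => //; near=> h.
rewrite /= mulmxDl -scalemxAl opprD addrACA subrr addr0 addrK scalerA mulVf ?scale1r//.
by near: h; exact: nbhs_dnbhs_neq.
Unshelve. all: by end_near. Qed.

End affine_maps.

(** * The parametrization, its differential and Gram matrix, and the flat Kaehler structure *)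

Section example.
Context {R : realType}.
Implicit Types (y z Y Z : 'rV[R]_4) (a b c d : R).

Definition row4 a b c d : 'rV[R]_4 := \row_(i < 4) nth 0 [:: a; b; c; d] i.

Lemma row4P y z : y 0 0 = z 0 0 -> y 0 1 = z 0 1 -> y 0 2 = z 0 2 ->
  y 0 3 = z 0 3 -> y = z.
Proof.
move=> e0 e1 e2 e3; apply/rowP => -[[|[|[|[|//]]]] i4].
- by rewrite (_ : Ordinal i4 = 0)//; exact: val_inj.
- by rewrite (_ : Ordinal i4 = 1)//; exact: val_inj.
- by rewrite (_ : Ordinal i4 = 2)//; exact: val_inj.
- by rewrite (_ : Ordinal i4 = 3)//; exact: val_inj.
Qed.

Lemma row4E a b c d : ((row4 a b c d 0 0 = a) * (row4 a b c d 0 1 = b) *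
  (row4 a b c d 0 2 = c) * (row4 a b c d 0 3 = d))%type.
Proof. by do !split; rewrite mxE. Qed.

Lemma ex_w_gt0 y : 0 < ex_w y.
Proof. by rewrite ltr_wpDl// addr_ge0// sqr_ge0. Qed.

(** The differential of [ex_param] at [y] applied to [Y], in closed form (see [derive_ex_param]).
    All tangent vectors to the example are handled in this form. *)
Definition ex_dparam y Y : 'rV[R]_10 :=
  let t := y 0 0 in let s := y 0 1 in let u := y 0 2 in let v := y 0 3 in
  let dt := Y 0 0 in let ds := Y 0 1 in let du := Y 0 2 in let dv := Y 0 3 in
  \row_(i < 10) nth 0
    [:: dt * cos u - t * sin u * du; ds * cos u - s * sin u * du;
        dt * cos v - t * sin v * dv; ds * cos v - s * sin v * dv;
        dt * sin u + t * cos u * du; ds * sin u + s * cos u * du;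
        dt * sin v + t * cos v * dv; ds * sin v + s * cos v * dv; du; dv] i.

Definition ex_coords (x : 'rV[R]_10) : 'rV[R]_4 :=
  let X k (k10 : (k < 10)%N) := x 0 (Ordinal k10) in
  let u := X 8 isT in let v := X 9 isT in
  row4 (X 0 isT * cos u + X 4 isT * sin u) (X 1 isT * cos u + X 5 isT * sin u) u v.

Lemma ex_paramK : cancel (@ex_param R) ex_coords.
Proof.
move=> y; have := cos2Dsin2 (y 0 2) => cs.
apply: row4P; rewrite row4E !mxE//=.
- by rewrite -!mulrA -mulrDr -!expr2 cs mulr1.
- by rewrite -!mulrA -mulrDr -!expr2 cs mulr1.
Qed.

(** Stated for a composite with an arbitrary smooth [G] because this avoids a general chain rule:
    the entries are products of entries of [G] with their sines and cosines. *)
Lemma smooth_ex_param_comp (V : normedModType R) (G : V -> 'rV[R]_4) :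
  smooth [set: V] G -> smooth [set: V] (fun x => ex_param (G x)).
Proof.
move=> sG; have {}sG k := smooth_mx_coord 0 k sG.
apply: smooth_mx => i [j j10]; under eq_fun do rewrite mxE.
by do 10?[case: j j10 => [|j] j10 /=; first by
  do ?apply: smoothM; do ?[apply: smooth_cos|apply: smooth_sin]; exact: sG].
Qed.

Lemma smooth_ex_coords_comp (V : normedModType R) (G : V -> 'rV[R]_10) :
  smooth [set: V] G -> smooth [set: V] (fun x => ex_coords (G x)).
Proof.
move=> sG; have {}sG k := smooth_mx_coord 0 k sG.
apply: smooth_mx => i [j j4]; under eq_fun do rewrite mxE.
by do 4?[case: j j4 => [|j] j4 /=; first by
  do ?apply: smoothD; do ?apply: smoothM;
  do ?[apply: smooth_cos|apply: smooth_sin]; exact: sG].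
Qed.

Lemma smooth_ex_dparam_comp (V : normedModType R) (G : V -> 'rV[R]_4) Y :
  smooth [set: V] G -> smooth [set: V] (fun x => ex_dparam (G x) Y).
Proof.
move=> sG; have {}sG k := smooth_mx_coord 0 k sG.
apply: smooth_mx => i [j j10]; under eq_fun do rewrite mxE.
by do 10?[case: j j10 => [|j] j10 /=; first by
  do ?[apply: smoothD|apply: smoothN|apply: smoothM];
  do ?[apply: smooth_cos|apply: smooth_sin]; exact: sG || exact: smooth_cst].
Qed.

Lemma smooth_ex_param : smooth [set: 'rV[R]_4] (@ex_param R).
Proof. exact: smooth_ex_param_comp (@smooth_id _ _). Qed.

Lemma smooth_ex_coords : smooth [set: 'rV[R]_10] ex_coords.
Proof. exact: smooth_ex_coords_comp (@smooth_id _ _). Qed.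

Lemma ex_param_diff y : differentiable (@ex_param R) y.
Proof. exact: smooth_differentiable smooth_ex_param. Qed.

Lemma ex_coords_diff x : differentiable ex_coords x.
Proof. exact: smooth_differentiable smooth_ex_coords. Qed.

Lemma derive_ex_param y Y : 'D_Y (@ex_param R) y = ex_dparam y Y.
Proof.
(* [dX], [dC] and [dS] serve as local instances from which [derive_val] assembles the derivatives of
   the ten entries. *)
have dX i : is_derive y Y (fun y : 'rV[R]_4 => y 0 i : R^o) (Y 0 i).
  have d : differentiable (fun y : 'rV[R]_4 => y 0 i : R^o) y.
    exact: differentiable_coord.
  apply: DeriveDef; first exact: diff_derivable.
  by rewrite -(@derive_coord _ _ _ _ id)// derive_id.
have dC i : is_derive y Y (fun y : 'rV[R]_4 => cos (y 0 i) : R^o)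
    (- sin (y 0 i) * Y 0 i).
  have d : differentiable (fun y : 'rV[R]_4 => y 0 i : R^o) y.
    exact: differentiable_coord.
  have [d1 d2] := derive_comp_scalar Y (is_derive_cos (y 0 i)) d.
  apply: DeriveDef; first exact: diff_derivable.
  by rewrite d2 (derive_val (is_derive := dX i)).
have dS i : is_derive y Y (fun y : 'rV[R]_4 => sin (y 0 i) : R^o)
    (cos (y 0 i) * Y 0 i).
  have d : differentiable (fun y : 'rV[R]_4 => y 0 i : R^o) y.
    exact: differentiable_coord.
  have [d1 d2] := derive_comp_scalar Y (is_derive_sin (y 0 i)) d.
  apply: DeriveDef; first exact: diff_derivable.
  by rewrite d2 (derive_val (is_derive := dX i)).
have dXC i k : 'D_Y (fun y : 'rV[R]_4 => y 0 i * cos (y 0 k) : R^o) y =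
    Y 0 i * cos (y 0 k) - y 0 i * sin (y 0 k) * Y 0 k.
  by rewrite derive_val /GRing.scale/=; ring.
have dXS i k : 'D_Y (fun y : 'rV[R]_4 => y 0 i * sin (y 0 k) : R^o) y =
    Y 0 i * sin (y 0 k) + y 0 i * cos (y 0 k) * Y 0 k.
  by rewrite derive_val /GRing.scale/=; ring.
apply/rowP => -[j j10]; rewrite derive_coord; last exact: ex_param_diff.
under [X in derive X _ _]eq_fun do rewrite mxE.
rewrite mxE.
by do 10?[case: j j10 => [|j] j10 /=; first by rewrite ?dXC ?dXS ?derive_val].
Qed.

Lemma ip_euclidean n (p X Y : 'rV[R]_n) :
  ip (@euclidean_metric R n) p X Y = \sum_i X 0 i * Y 0 i.
Proof.
by rewrite /ip /euclidean_metric mulmx1 mxE; apply: eq_bigr => i _; rewrite mxE.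
Qed.

Lemma ip_euclidean_nth (r s : seq R) p :
  ip (@euclidean_metric R 10) p (\row_i nth 0 r i) (\row_i nth 0 s i) =
  r`_0 * s`_0 + (r`_1 * s`_1 + (r`_2 * s`_2 + (r`_3 * s`_3 + (r`_4 * s`_4 +
  (r`_5 * s`_5 + (r`_6 * s`_6 + (r`_7 * s`_7 + (r`_8 * s`_8 + r`_9 * s`_9)))))))).
Proof.
by rewrite ip_euclidean !big_ord_recl big_ord0 addr0 !mxE.
Qed.

(** The coefficient 2 is one cos^2 + sin^2 from each of u and v. In [ex_w] the part t^2 + s^2 comes
    from rotating the first eight entries, and the 1 from the entries u and v themselves. Radial and
    rotational directions are orthogonal, and d_u, d_v have disjoint supports. *)
Lemma ip_ex_dparam y Y Z p :
  ip (@euclidean_metric R 10) p (ex_dparam y Y) (ex_dparam y Z) =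
  2 * (Y 0 0 * Z 0 0) + 2 * (Y 0 1 * Z 0 1)
  + ex_w y * (Y 0 2 * Z 0 2 + Y 0 3 * Z 0 3).
Proof.
rewrite ip_euclidean_nth /= /ex_w.
ring: (sin2cos2 (y 0 2)) (sin2cos2 (y 0 3)).
Qed.

Lemma mul_canonical_J (X p : 'rV[R]_10) (i : 'I_10) : (X *m canonical_J p) 0 i =
  nth 0 [:: - X 0 1; X 0 0; - X 0 3; X 0 2; - X 0 5; X 0 4; - X 0 7; X 0 6;
            - X 0 9; X 0 8] i.
Proof.
rewrite mxE; under eq_bigr do rewrite mxE.
rewrite !big_ord_recl big_ord0.
case: i => j j10.
by do 10?[case: j j10 => [|j] j10 /=; first by
  rewrite ?eqxx /= ?(mulr0, mulr1, oppr0, mulrN, addr0, add0r) //;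
  congr (_ _); try congr (_ _); exact: val_inj].
Qed.

(** Each of the first four coordinate planes of [J] carries (t, s) times one trigonometric factor,
    so [J] acts on (dt, ds) as a quarter turn; the last plane receives nothing from dt and ds. *)
Lemma ex_dparam_J y (a b : R) p :
  ex_dparam y (row4 a b 0 0) *m canonical_J p = ex_dparam y (row4 (- b) a 0 0).
Proof.
apply/rowP => i; rewrite mul_canonical_J [RHS]mxE.
case: i => j j10.
by do 10?[case: j j10 => [|j] j10 /=; first by rewrite !mxE/=; ring].
Qed.

(** Only the plane of the last two entries contributes: in the first eight, the u and v parts live
    in different planes, and the terms pairing [J] d_u with d_t or d_s cancel between the cosine and
    the sine entries. *)
Lemma ip_ex_dparam_J y Y c d p :
  ip (@euclidean_metric R 10) p (ex_dparam y (row4 0 0 c d) *m canonical_J p) (ex_dparam y Y) =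
  c * Y 0 3 - d * Y 0 2.
Proof.
rewrite (_ : ex_dparam y (row4 0 0 c d) *m canonical_J p = \row_i nth 0
  (let r := ex_dparam y (row4 0 0 c d) in
   [:: - r 0 1; r 0 0; - r 0 3; r 0 2; - r 0 5; r 0 4; - r 0 7; r 0 6;
            - r 0 9; r 0 8]) i); last first.
  by apply/rowP => i; rewrite mul_canonical_J [RHS]mxE.
rewrite ip_euclidean_nth /= /ex_dparam !row4E !mxE /=.
ring: (sin2cos2 (y 0 2)) (sin2cos2 (y 0 3)).
Qed.

(** Skew-symmetry turns [J *m J = - 1%:M] into orthogonality, which is the Hermitian condition. *)
Lemma canonical_J_tr p : (canonical_J p)^T = - canonical_J p :> 'M[R]_10.
Proof.
apply/matrixP => i j; rewrite !mxE.
have nSS (k : nat) : (k == k.+2) = false by rewrite ltn_eqF.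
have [->|nij] := eqVneq (i : nat) j.+1.
  by rewrite oddS (eq_sym j.+2) nSS; case: odd; rewrite ?oppr0 ?opprK.
have [->|nji] := eqVneq (j : nat) i.+1.
  by rewrite oddS; case: odd; rewrite ?oppr0 ?opprK.
by do 2 case: odd; rewrite ?oppr0.
Qed.

Lemma canonical_J_sqr p : canonical_J p *m canonical_J p = - 1%:M :> 'M[R]_10.
Proof.
apply/row_matrixP => k; rewrite row_mul; apply/rowP => i.
rewrite mul_canonical_J rowE !mul_canonical_J !mxE.
case: i => j j10.
by do 10?[case: j j10 => [|j] j10 /=; first by rewrite -!val_eqE/= (eq_sym (k : nat))].
Qed.

Lemma ip_canonical_J (p X Y : 'rV[R]_10) :
  ip (@euclidean_metric R 10) p (X *m canonical_J p) (Y *m canonical_J p) =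
  ip (@euclidean_metric R 10) p X Y.
Proof.
rewrite /ip /euclidean_metric !mulmx1 trmx_mul canonical_J_tr.
by rewrite mulmxA -(mulmxA X) mulmxN canonical_J_sqr opprK mulmx1.
Qed.

(** The factor [a] covers both the Euclidean metric and the rescaled metric [ex_gth] on the slant
    leaf. *)
Lemma riemannian_scalar n (B : set 'rV[R]_n) (a : R) : 0 < a ->
  riemannian B (fun p => a *: @euclidean_metric R n p).
Proof.
move=> a0; have ipE (p X Y : 'rV[R]_n) : ip (fun p => a *: euclidean_metric p) p X Y =
    a * \sum_i X 0 i * Y 0 i.
  by rewrite -(ip_euclidean p) /ip -scalemxAr -scalemxAl mxE.
split; first by apply: smooth_smooth_on; exact: (@smooth_cst _ _ _ _ (a *: 1%:M)).
move=> p _; split=> [X Y _ _|X _ X0]; rewrite !ipE.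
  by congr (_ * _); apply: eq_bigr => i _; exact: mulrC.
rewrite mulr_gt0// lt_neqAle sumr_ge0 ?andbT; last by move=> i _; rewrite -expr2 sqr_ge0.
apply: contra X0; rewrite eq_sym psumr_eq0; last by move=> i _; rewrite -expr2 sqr_ge0.
move=> /allP X0; apply/eqP/rowP => i; rewrite mxE; apply/eqP.
by have := X0 i (mem_index_enum i); rewrite /= mulf_eq0 orbb.
Qed.

Lemma riemannian_euclidean n (B : set 'rV[R]_n) : riemannian B (@euclidean_metric R n).
Proof.
rewrite (_ : @euclidean_metric R n = fun p => 1 *: euclidean_metric p).
  exact: riemannian_scalar.
by apply/funext => p; rewrite scale1r.
Qed.

(** Both fields are constant, so all Christoffel symbols and all partial derivatives of [J]
    vanish. *)
Lemma kaehler_canonical_J : kaehler (@euclidean_metric R 10) (@canonical_J R).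
Proof.
have partial0 i (c : R) (q : 'rV[R]_10) : partial i (fun=> c : R^o) q = 0.
  exact: derive_cst.
split; [exact: riemannian_euclidean|exact: smooth_cst|exact: canonical_J_sqr|
  exact: ip_canonical_J|] => p i j k.
have chr0 (a b c : 'I_10) : christoffel (@euclidean_metric R 10) p a b c = 0.
  rewrite /christoffel big1 ?mulr0// => l _.
  by rewrite /euclidean_metric !partial0 subr0 addr0 mulr0.
rewrite /nablaJ partial0 add0r !big1 ?subrr// => l _; rewrite chr0 ?mulr0 ?mul0r//.
Qed.

End example.

(** * Affine coordinate slices: submanifolds, tangent spaces and distributions *)

Section slices.
Context {R : realType}.
Implicit Types (y z Y Z : 'rV[R]_4) (a b c d : R).

Lemma open_ex_domain : open (@ex_domain R).
Proof.
have oc (i : 'I_4) (D : set R) : open D -> open [set y : 'rV[R]_4 | D (y 0 i)].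
  move=> oD; apply: (@open_comp _ _ (fun y : 'rV[R]_4 => y 0 i)) => // y _.
  exact: coord_continuous.
pose D01 := [set x : R | x != 0] `&` [set x | x != 1].
pose D23 := [set x : R | x > 0] `&` [set x | x < pi / 2].
have o01 : open D01 by apply: openI; exact: open_neq.
have o23 : open D23 by apply: openI; [exact: open_gt|exact: open_lt].
rewrite (_ : @ex_domain R = [set y | D01 (y 0 0)] `&` [set y | D01 (y 0 1)] `&`
  ([set y | D23 (y 0 2)] `&` [set y | D23 (y 0 3)])).
  by do !apply: openI; exact: oc.
rewrite predeqE => y; split; first by case=> -[? ?] [? ?] /andP[? ?] /andP[? ?].
by case=> -[[? ?] [? ?]] [[? ?] [? ?]]; split=> //; apply/andP.
Qed.

(** A common form for the three manifolds involved: the identity matrix gives the whole domain,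
    [T_mx] and [th_mx] give the two families of leaves. *)
Definition slice k (A : 'M[R]_(k, 4)) y0 : set 'rV[R]_4 :=
  [set y | ex_domain y /\ exists z : 'rV_k, y = z *m A + y0].

Section slice_image.
Variables (k : nat) (A : 'M[R]_(k, 4)) (B : 'M[R]_(4, k)) (y0 : 'rV[R]_4).
Hypothesis AB1 : A *m B = 1%:M.

Let phi (z : 'rV[R]_k) : 'rV[R]_10 := ex_param (z *m A + y0).
(** Left inverse of [phi]: recover y from x, subtract y0, and undo [A] by its right inverse [B]. The
    expression is kept in the shape [y *m B + b] of an affine map. *)
Let psi (x : 'rV[R]_10) : 'rV[R]_k := ex_coords x *m B + - (y0 *m B).
Let U := [set z : 'rV[R]_k | ex_domain (z *m A + y0)].

Let affine_diff m n (C : 'M[R]_(m, n)) (b : 'rV[R]_n) x :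
  differentiable (fun x : 'rV[R]_m => x *m C + b) x.
Proof. exact: smooth_differentiable (smooth_affine C b). Qed.

Let phi_smooth : smooth [set: 'rV[R]_k] phi.
Proof.
apply: (@smooth_comp_affine _ _ _ _ (@ex_param R) _ (mulmx^~ A)).
- exact: affine_diff.
- exact: derive_affine.
- exact: smooth_ex_param.
Qed.

Let psi_diff x : differentiable psi x.
Proof.
apply: (@differentiable_comp _ _ _ _ (@ex_coords R) (fun y => y *m B + - (y0 *m B))).
  exact: ex_coords_diff.
exact: affine_diff.
Qed.

Let phiK : cancel phi psi.
Proof. by move=> z; rewrite /psi ex_paramK mulmxDl addrK -mulmxA AB1 mulmx1. Qed.

Let open_U : open U.
Proof.
apply: (@open_comp _ _ (fun z : 'rV[R]_k => z *m A + y0)); last exact: open_ex_domain.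
by move=> z _; exact: differentiable_continuous.
Qed.

Let image_slice : @ex_param R @` slice A y0 = phi @` U.
Proof.
rewrite predeqE => x; split=> [[y [Dy [z yz]] <-]|[z Uz <-]].
  by exists z; rewrite /phi /U -?yz //= -yz.
by exists (z *m A + y0) => //; split=> //; exists z.
Qed.

Lemma parametrizes_slice : parametrizes U phi (@ex_param R @` slice A y0).
Proof. by rewrite image_slice; exact: parametrizes_retract psi_diff phiK _. Qed.

Lemma submanifold_slice : submanifold k (@ex_param R @` slice A y0).
Proof.
move=> p Mp; exists U, phi; split; first exact: parametrizes_slice.
by rewrite -image_slice.
Qed.

Lemma tangent_slice y : slice A y0 y ->
  tangent (@ex_param R @` slice A y0) (ex_param y) =
  [set ex_dparam y (Z *m A) | Z in [set: 'rV[R]_k]].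
Proof.
case=> Dy [z yz]; rewrite image_slice yz -/(phi z).
rewrite (tangent_retract phi_smooth psi_diff phiK)//; last by rewrite /U/= -yz.
have D (Z : 'rV[R]_k) : 'D_Z phi z = ex_dparam (z *m A + y0) (Z *m A).
  have := derive_comp Z (affine_diff A y0 z) (ex_param_diff (z *m A + y0)).
  by rewrite derive_affine derive_ex_param.
by rewrite predeqE => X; split=> -[Z _ <-]; exists Z.
Qed.

End slice_image.

Definition row2 a b : 'rV[R]_2 := \row_(i < 2) nth 0 [:: a; b] i.

Definition T_mx : 'M[R]_(2, 4) := \matrix_(i < 2, j < 4) (i == j :> nat)%:R.
Definition th_mx : 'M[R]_(2, 4) := \matrix_(i < 2, j < 4) (i.+2 == j :> nat)%:R.

Lemma mul_T_mx (Z : 'rV[R]_2) : Z *m T_mx = row4 (Z 0 0) (Z 0 1) 0 0.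
Proof.
by apply: row4P; rewrite row4E mxE !big_ord_recl big_ord0 !mxE/= ?(mulr0, mulr1, addr0, add0r)//;
  congr (Z _ _); exact: val_inj.
Qed.

Lemma mul_th_mx (Z : 'rV[R]_2) : Z *m th_mx = row4 0 0 (Z 0 0) (Z 0 1).
Proof.
by apply: row4P; rewrite row4E mxE !big_ord_recl big_ord0 !mxE/= ?(mulr0, mulr1, addr0, add0r)//;
  congr (Z _ _); exact: val_inj.
Qed.

Lemma row2P (u v : 'rV[R]_2) : u 0 0 = v 0 0 -> u 0 1 = v 0 1 -> u = v.
Proof.
move=> e0 e1; apply/rowP => -[[|[|//]] i2].
- by rewrite (_ : Ordinal i2 = 0)//; exact: val_inj.
- by rewrite (_ : Ordinal i2 = 1)//; exact: val_inj.
Qed.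

Lemma row2E a b : ((row2 a b 0 0 = a) * (row2 a b 0 1 = b))%type.
Proof. by split; rewrite mxE. Qed.

Lemma T_mxK : T_mx *m T_mx^T = 1%:M.
Proof.
apply/row_matrixP => i; rewrite !rowE mulmxA mul_T_mx mulmx1.
by apply: row2P; rewrite mxE !big_ord_recl big_ord0 !mxE/= ?(mulr0, mulr1, addr0, add0r).
Qed.

Lemma th_mxK : th_mx *m th_mx^T = 1%:M.
Proof.
apply/row_matrixP => i; rewrite !rowE mulmxA mul_th_mx mulmx1.
by apply: row2P; rewrite mxE !big_ord_recl big_ord0 !mxE/= ?(mulr0, mulr1, addr0, add0r).
Qed.

Lemma ex_M_slice : @ex_M R = @ex_param R @` slice 1%:M 0.
Proof.
congr image; rewrite predeqE => y; split=> [Dy|[]//].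
by split=> //; exists y; rewrite mulmx1 addr0.
Qed.

Lemma ex_MT_slice y0 : ex_MT y0 = @ex_param R @` slice T_mx y0.
Proof.
congr image; rewrite predeqE => y; split.
  move=> [Dy y2 y3]; split=> //; exists (row2 (y 0 0 - y0 0 0) (y 0 1 - y0 0 1)).
  by rewrite mul_T_mx !row2E; apply: row4P; rewrite mxE row4E ?subrK ?add0r.
by move=> [Dy [z yz]]; split=> //; rewrite yz mul_T_mx mxE row4E add0r.
Qed.

Lemma ex_Mth_slice y0 : ex_Mth y0 = @ex_param R @` slice th_mx y0.
Proof.
congr image; rewrite predeqE => y; split.
  move=> [Dy y2 y3]; split=> //; exists (row2 (y 0 2 - y0 0 2) (y 0 3 - y0 0 3)).
  by rewrite mul_th_mx !row2E; apply: row4P; rewrite mxE row4E ?subrK ?add0r.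
by move=> [Dy [z yz]]; split=> //; rewrite yz mul_th_mx mxE row4E add0r.
Qed.

Lemma ex_dparam_lin y a b Y Z :
  a *: ex_dparam y Y + b *: ex_dparam y Z = ex_dparam y (a *: Y + b *: Z).
Proof. by rewrite -!derive_ex_param !deriveE ?linearD ?linearZ//; exact: ex_param_diff. Qed.

Lemma ex_dparam_mulmx y k (A : 'M[R]_(k, 4)) (v : 'rV[R]_k) :
  v *m (\matrix_(i < k) ex_dparam y (row i A)) = ex_dparam y (v *m A).
Proof.
rewrite !mulmx_sum_row -derive_ex_param deriveE ?linear_sum; last exact: ex_param_diff.
apply: eq_bigr => i _; rewrite rowK linearZ/= -deriveE ?derive_ex_param//.
exact: ex_param_diff.
Qed.

(** The global left inverse makes [ex_param] an immersion on all of R^4, so the retraction lemma is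
    applied with the full space as open set. *)
Lemma ex_dparam_eq0 y Y : ex_dparam y Y = 0 -> Y = 0.
Proof.
move=> Y0; have : 'd (@ex_param R) y Y = 'd (@ex_param R) y 0.
  rewrite linear0 -deriveE; last exact: ex_param_diff.
  by rewrite derive_ex_param.
have [_ _ inj _ _] := parametrizes_retract smooth_ex_param ex_coords_diff (@ex_paramK R) openT.
exact: inj.
Qed.

(** [ex_span] quantifies over the preimages of a point; injectivity of [ex_param] leaves only the
    given [y]. *)
Lemma ex_spanE i j y (X : 'rV[R]_10) : ex_domain y -> ex_span i j (ex_param y) X <->
  exists a b, X = ex_dparam y (a *: delta_mx 0 i + b *: delta_mx 0 j).
Proof.
have E a b : a *: partial i (@ex_param R) y + b *: partial j (@ex_param R) y =
    ex_dparam y (a *: delta_mx 0 i + b *: delta_mx 0 j).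
  by rewrite /partial !derive_ex_param ex_dparam_lin.
move=> Dy; split; last by move=> [a [b ->]]; exists y; split=> //; exists a, b.
move=> [y' [_ /(can_inj (@ex_paramK R)) -> [a [b ->]]]]; exists a, b.
exact: E.
Qed.

Lemma ex_DTE y (X : 'rV[R]_10) : ex_domain y -> ex_DT (ex_param y) X <->
  exists a b, X = ex_dparam y (row4 a b 0 0).
Proof.
move=> Dy; rewrite /ex_DT ex_spanE//.
suff E a b : a *: delta_mx 0 0 + b *: delta_mx 0 1 = row4 a b 0 0.
  by split=> -[a [b ->]]; exists a, b; rewrite E.
by apply: row4P; rewrite row4E !mxE/= ?(mulr0, mulr1, addr0, add0r).
Qed.

Lemma ex_DthE y (X : 'rV[R]_10) : ex_domain y -> ex_Dth (ex_param y) X <->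
  exists a b, X = ex_dparam y (row4 0 0 a b).
Proof.
move=> Dy; rewrite /ex_Dth ex_spanE//.
suff E a b : a *: delta_mx 0 2 + b *: delta_mx 0 3 = row4 0 0 a b.
  by split=> -[a [b ->]]; exists a, b; rewrite E.
by apply: row4P; rewrite row4E !mxE/= ?(mulr0, mulr1, addr0, add0r).
Qed.

Lemma ex_DT_mx y : ex_domain y ->
  ex_DT (ex_param y) = [set ex_dparam y (Z *m T_mx) | Z in [set: 'rV[R]_2]].
Proof.
move=> Dy; rewrite predeqE => X; rewrite ex_DTE//.
split=> [[a [b ->]]|[Z _ <-]]; last by exists (Z 0 0), (Z 0 1); rewrite mul_T_mx.
by exists (row2 a b) => //; rewrite mul_T_mx !row2E.
Qed.

Lemma ex_Dth_mx y : ex_domain y ->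
  ex_Dth (ex_param y) = [set ex_dparam y (Z *m th_mx) | Z in [set: 'rV[R]_2]].
Proof.
move=> Dy; rewrite predeqE => X; rewrite ex_DthE//.
split=> [[a [b ->]]|[Z _ <-]]; last by exists (Z 0 0), (Z 0 1); rewrite mul_th_mx.
by exists (row2 a b) => //; rewrite mul_th_mx !row2E.
Qed.

Lemma tangent_ex_M y (X : 'rV[R]_10) : ex_domain y -> tangent (@ex_M R) (ex_param y) X <->
  exists Y, X = ex_dparam y Y.
Proof.
move=> Dy; rewrite ex_M_slice (@tangent_slice _ _ 1%:M) ?mulmx1//.
  by split=> [[Y _ <-]|[Y ->]]; exists Y; rewrite ?mulmx1.
by split=> //; exists y; rewrite mulmx1 addr0.
Qed.

Lemma integral_manifold_MT y0 : ex_domain y0 ->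
  integral_manifold (@ex_M R) (@ex_DT R) (ex_MT y0).
Proof.
move=> D0; split.
- by exists (ex_param y0), y0.
- by move=> _ [y [Dy _ _] <-]; exists y.
- by exists 2; rewrite ex_MT_slice; exact: submanifold_slice T_mxK.
rewrite ex_MT_slice => _ [y Sy <-]; rewrite (tangent_slice T_mxK Sy).
by rewrite ex_DT_mx//; case: Sy.
Qed.

Lemma integral_manifold_Mth y0 : ex_domain y0 ->
  integral_manifold (@ex_M R) (@ex_Dth R) (ex_Mth y0).
Proof.
move=> D0; split.
- by exists (ex_param y0), y0.
- by move=> _ [y [Dy _ _] <-]; exists y.
- by exists 2; rewrite ex_Mth_slice; exact: submanifold_slice th_mxK.
rewrite ex_Mth_slice => _ [y Sy <-]; rewrite (tangent_slice th_mxK Sy).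
by rewrite ex_Dth_mx//; case: Sy.
Qed.

(** Through [ex_coords] the frame becomes a smooth matrix field on all of R^10, so one neighbourhood
    serves every point. Its rows are independent because [ex_dparam] is injective in the direction
    and [B] recovers [v] from [v *m A]. *)
Lemma smooth_distribution_frame k (A : 'M[R]_(k, 4)) B (D : 'rV[R]_10 -> set 'rV[R]_10) :
  A *m B = 1%:M ->
  (forall y, ex_domain y ->
    D (ex_param y) = [set ex_dparam y (Z *m A) | Z in [set: 'rV[R]_k]]) ->
  smooth_distribution k (@ex_M R) D.
Proof.
move=> AB1 DE _ [y Dy <-]; split.
  by rewrite DE// => _ [Z _ <-]; apply/tangent_ex_M => //; exists (Z *m A).
exists [set: 'rV[R]_10], (fun x => \matrix_(i < k) ex_dparam (ex_coords x) (row i A)).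
split=> //; first exact: openT.
  apply: smooth_mx => i j; under eq_fun do rewrite mxE.
  apply: smooth_mx_coord; apply: smooth_ex_dparam_comp; exact: smooth_ex_coords.
move=> _ [z Dz <-] _; rewrite ex_paramK; split.
  apply: inj_row_free => v; rewrite ex_dparam_mulmx => /ex_dparam_eq0 vA.
  by rewrite -[v]mulmx1 -AB1 mulmxA vA mul0mx.
rewrite DE// predeqE => X; split=> [[Z _ <-]|/submxP[Z ->]].
  by rewrite /= -ex_dparam_mulmx submxMl.
by exists Z => //; rewrite ex_dparam_mulmx.
Qed.

End slices.

(** * The slant function, and the warped product decomposition *)

Section warped_example.
Context {R : realType}.
Implicit Types (y z Y Z : 'rV[R]_4) (a b c d : R).

Let g := @euclidean_metric R 10.
Let J := @canonical_J R.

Definition ex_theta (x : 'rV[R]_10) : R := acos (1 / ex_w (ex_coords x)).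
Definition ex_f (x : 'rV[R]_10) : R := Num.sqrt (ex_w (ex_coords x)).

Lemma acos_anti (a b : R) : -1 <= a <= 1 -> -1 <= b <= 1 -> a <= b ->
  acos b <= acos a.
Proof.
move=> a1 b1 ab; rewrite leNgt; apply/negP => lt_acos.
have : cos (acos b) < cos (acos a).
  by rewrite ltr_cos// in_itv/= acos_ge0 ?acos_lepi.
by rewrite !acosK// ltNge ab.
Qed.

Lemma inf_min (S : set R) m : S m -> lbound S m -> inf S = m.
Proof.
move=> Sm lbm; apply/eqP; rewrite eq_le; apply/andP; split.
  by apply: ge_inf => //; exists m.
by apply: lb_le_inf => //; exists m.
Qed.

(** For directions (a, b) and (c, d) in D^theta the cosine is (a d - b c) / (w |(a, b)| |(c, d)|).
    It is at most 1 / w, with equality at the quarter turn (-b, a), so the infimum is attained and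
    does not depend on (a, b). *)
Lemma slant_angle y a b : ex_domain y -> ex_dparam y (row4 0 0 a b) != 0 ->
  angle_to g (ex_param y) (ex_dparam y (row4 0 0 a b) *m J (ex_param y))
    (ex_Dth (ex_param y)) = ex_theta (ex_param y).
Proof.
move=> Dy X0; pose w := ex_w y; have w0 : 0 < w := ex_w_gt0 y.
have n_gt0 c d : ex_dparam y (row4 0 0 c d) != 0 -> 0 < c ^+ 2 + d ^+ 2.
  apply: contraR; rewrite -leNgt => cd0.
  have /eqP := le_anti (introT andP (conj cd0 (addr_ge0 (sqr_ge0 c) (sqr_ge0 d)))).
  rewrite paddr_eq0 ?sqr_ge0// !sqrf_eq0 => /andP[/eqP-> /eqP->].
  rewrite (_ : row4 0 0 0 0 = 0); last by apply: row4P; rewrite row4E mxE.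
  by have := ex_dparam_lin y 0 0 0 0; rewrite !scale0r !addr0 => <-.
have angleE c d : angle g (ex_param y) (ex_dparam y (row4 0 0 a b) *m J (ex_param y))
    (ex_dparam y (row4 0 0 c d)) =
    acos ((a * d - b * c) / (w * (Num.sqrt (a ^+ 2 + b ^+ 2) * Num.sqrt (c ^+ 2 + d ^+ 2)))).
  rewrite /angle ip_canonical_J ip_ex_dparam_J !ip_ex_dparam !row4E.
  rewrite !(mulr0, addr0, add0r) -!expr2 -/w !sqrtrM ?ltW// mulrACA -expr2 sqr_sqrtr//.
  exact: ltW.
have wi : 0 < w^-1 <= 1.
  by rewrite invr_gt0 w0 invf_le1// /w /ex_w lerDr addr_ge0// sqr_ge0.
have wi1 : -1 <= 1 / w <= 1 by case/andP: wi => ? ?; rewrite div1r; apply/andP; split; lra.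
have ab0 := n_gt0 _ _ X0.
rewrite /angle_to /ex_theta ex_paramK -/w; apply: inf_min.
  (* The minimiser is a multiple of the projection of [J] X to D^theta. *)
  exists (ex_dparam y (row4 0 0 (- b) a)).
    split; first by apply/ex_DthE => //; exists (- b), a.
    apply: contraNneq X0 => /ex_dparam_eq0 e.
    have := congr1 (fun y : 'rV[R]_4 => y 0 2) e; have := congr1 (fun y : 'rV[R]_4 => y 0 3) e.
    rewrite !row4E !mxE => a0 /eqP; rewrite oppr_eq0 => /eqP b0.
    by move: ab0; rewrite a0 b0 expr0n addr0 ltxx.
  rewrite angleE sqrrN (addrC (b ^+ 2)) -(expr2 (Num.sqrt _)) sqr_sqrtr ?ltW//.
  congr acos; rewrite mulrN opprK -!expr2; field.
  by rewrite (gt_eqF w0) (gt_eqF ab0).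
move=> _ [Y [/(ex_DthE _ Dy)[c [d ->]] Y0] <-]; rewrite angleE.
have cd0 := n_gt0 _ _ Y0.
set P := Num.sqrt _; set Q := Num.sqrt (c ^+ 2 + d ^+ 2).
have P0 : 0 < P by rewrite sqrtr_gt0.
have Q0 : 0 < Q by rewrite sqrtr_gt0.
(* Cauchy-Schwarz through the Lagrange identity, with defect (a c + b d)^2. The absolute value
   matters: the lower bound keeps the cosine at least -1, where [acos_anti] applies. *)
have nPQ : `|a * d - b * c| <= P * Q.
  rewrite -ler_sqr ?nnegrE ?mulr_ge0 ?(ltW P0) ?(ltW Q0)//.
  rewrite real_normK ?num_real// exprMn !sqr_sqrtr ?(ltW ab0) ?(ltW cd0)//.
  rewrite -subr_ge0 (_ : _ - _ = (a * c + b * d) ^+ 2); first exact: sqr_ge0.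
  by ring.
have r1 : `|(a * d - b * c) / (w * (P * Q))| <= 1 / w.
  rewrite normrM normfV (gtr0_norm (mulr_gt0 w0 (mulr_gt0 P0 Q0))).
  rewrite ler_pdivrMr ?mulr_gt0// mulrA div1r mulVf ?gt_eqF// mul1r//.
move: r1; rewrite ler_norml => /andP[rl rr]; apply: acos_anti => //.
by case/andP: wi1 => wl wr; rewrite (le_trans rr wr) andbT (le_trans _ rl)// lerN2.
Qed.

Lemma pointwise_slant_ex_Dth :
  pointwise_slant_distribution g J (@ex_M R) (@ex_Dth R) ex_theta.
Proof.
by move=> _ [y Dy <-] X /(ex_DthE _ Dy)[a [b ->]] X0; exact: slant_angle.
Qed.

Lemma pointwise_semi_slant_ex :
  pointwise_semi_slant g J (@ex_M R) (@ex_DT R) (@ex_Dth R) ex_theta.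
Proof.
split; first by exists 4; rewrite ex_M_slice; apply: submanifold_slice; exact: mulmx1.
split; first by exists 2; exact: smooth_distribution_frame T_mxK ex_DT_mx.
split; first by exists 2; exact: smooth_distribution_frame th_mxK ex_Dth_mx.
split; last split; last exact: pointwise_slant_ex_Dth.
  move=> _ [y Dy <-]; split.
    rewrite predeqE => X; rewrite tangent_ex_M//; split=> [[Y ->]|].
      exists (ex_dparam y (row4 (Y 0 0) (Y 0 1) 0 0)), (ex_dparam y (row4 0 0 (Y 0 2) (Y 0 3))).
      split; [by apply/ex_DTE => //; exists (Y 0 0), (Y 0 1)
             |by apply/ex_DthE => //; exists (Y 0 2), (Y 0 3)|].
      rewrite -[X in X + _]scale1r -[X in _ + X]scale1r ex_dparam_lin !scale1r.
      by congr ex_dparam; apply: row4P; rewrite mxE !row4E ?addr0 ?add0r.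
    move=> [X1 [X2 [/(ex_DTE _ Dy)[a [b ->]] /(ex_DthE _ Dy)[c [d ->]] ->]]].
    exists (1 *: row4 a b 0 0 + 1 *: row4 0 0 c d).
    by rewrite -ex_dparam_lin !scale1r.
  move=> X Y /(ex_DTE _ Dy)[a [b ->]] /(ex_DthE _ Dy)[c [d ->]].
  by rewrite ip_ex_dparam !row4E !(mulr0, mul0r, addr0).
move=> _ [y Dy <-]; rewrite predeqE => X; split.
  move=> [_ /(ex_DTE _ Dy)[a [b ->]] <-]; rewrite ex_dparam_J.
  by apply/ex_DTE => //; exists (- b), a.
(* The preimage is given by the inverse of [J], which is its opposite. *)
move=> /(ex_DTE _ Dy)[a [b ->]]; exists (ex_dparam y (row4 b (- a) 0 0)).
  by apply/ex_DTE => //; exists b, (- a).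
by rewrite ex_dparam_J opprK.
Qed.

Lemma holomorphic_ex_MT y0 : ex_domain y0 -> holomorphic_submanifold J (ex_MT y0).
Proof.
move=> D0; have [_ _ k_sub TE] := integral_manifold_MT D0; split=> // p Np X.
rewrite TE//; case: Np => y [Dy _ _] <- /(ex_DTE _ Dy)[a [b ->]].
by rewrite ex_dparam_J; apply/ex_DTE => //; exists (- b), a.
Qed.

(** The tangent spaces of the leaf are those of D^theta, so it inherits the slant function; its
    cosine 1 / w is nonzero, which excludes a right angle. *)
Lemma proper_slant_ex_Mth y0 : ex_domain y0 ->
  proper_pointwise_slant_submanifold g J (ex_Mth y0).
Proof.
move=> D0; have [_ sub k_sub TE] := integral_manifold_Mth D0; split=> //.
exists ex_theta; split.
  by move=> p Np X; rewrite TE// => DX X0; exact: pointwise_slant_ex_Dth (sub _ Np) _ DX X0.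
move=> p _; apply/eqP => /(congr1 cos); rewrite cos_pihalf acosK.
  by move/eqP; rewrite div1r invr_eq0 gt_eqF// ex_w_gt0.
have w1 : 1 <= ex_w (ex_coords p) by rewrite /ex_w lerDr addr_ge0// sqr_ge0.
have w0 := ex_w_gt0 (ex_coords p).
rewrite in_itv/= div1r invf_le1// w1 andbT (le_trans (lerN10 _))//.
by rewrite invr_ge0 ltW.
Qed.

Definition mix y z := row4 (y 0 0) (y 0 1) (z 0 2) (z 0 3).

Definition ex_Psi (x : 'rV[R]_(10 + 10)) : 'rV[R]_10 :=
  ex_param (mix (ex_coords (lsubmx x)) (ex_coords (rsubmx x))).

(** Projects x to the two base leaves: one component keeps its (t, s) and takes (u, v) from [y0],
    the other does the opposite. *)
Definition ex_Psi_inv y0 (x : 'rV[R]_10) : 'rV[R]_(10 + 10) :=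
  row_mx (ex_param (mix (ex_coords x) y0)) (ex_param (mix y0 (ex_coords x))).

(** The conditions on (t, s) and on (u, v) are independent; this is what makes the product
    decomposition global. *)
Lemma mix_domain y z : ex_domain y -> ex_domain z -> ex_domain (mix y z).
Proof. by move=> [y0 y1 _ _] [_ _ z2 z3]; split; rewrite row4E. Qed.

Lemma mixE y z : ((mix y z 0 0 = y 0 0) * (mix y z 0 1 = y 0 1) *
  (mix y z 0 2 = z 0 2) * (mix y z 0 3 = z 0 3))%type.
Proof. by rewrite !row4E. Qed.

Lemma smooth_mix (V : normedModType R) (F G : V -> 'rV[R]_4) :
  smooth [set: V] F -> smooth [set: V] G ->
  smooth [set: V] (fun x => mix (F x) (G x)).
Proof.
move=> sF sG; have {}sF k := smooth_mx_coord 0 k sF.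
have {}sG k := smooth_mx_coord 0 k sG.
apply: smooth_mx => i [j j4]; under eq_fun do rewrite mxE.
by do 4?[case: j j4 => [|j] j4 /=; first exact: sF || exact: sG].
Qed.

Lemma smooth_lsubmx m n : smooth [set: 'rV[R]_(m + n)] lsubmx.
Proof.
apply: smooth_mx => i j; under eq_fun do rewrite mxE; exact: smooth_coord.
Qed.

Lemma smooth_rsubmx m n : smooth [set: 'rV[R]_(m + n)] rsubmx.
Proof.
apply: smooth_mx => i j; under eq_fun do rewrite mxE; exact: smooth_coord.
Qed.

Lemma smooth_ex_Psi : smooth [set: 'rV[R]_(10 + 10)] ex_Psi.
Proof.
apply: smooth_ex_param_comp; apply: smooth_mix; apply: smooth_ex_coords_comp.
  exact: smooth_lsubmx.
exact: smooth_rsubmx.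
Qed.

Lemma smooth_ex_Psi_inv y0 : smooth [set: 'rV[R]_10] (ex_Psi_inv y0).
Proof.
apply: smooth_row_mx; apply: smooth_ex_param_comp; apply: smooth_mix;
  solve [exact: smooth_ex_coords | exact: smooth_cst].
Qed.

Lemma smooth_ex_f : smooth [set: 'rV[R]_10] (ex_f : _ -> R^o).
Proof.
have sX k : smooth [set: 'rV[R]_10] ((fun x => ex_coords x 0 k) : _ -> R^o).
  by apply: smooth_mx_coord; exact: smooth_ex_coords.
apply: smooth_sqrt => [x|]; first exact: ex_w_gt0.
rewrite /ex_w; apply: smoothD; last exact: smooth_cst.
by apply: smoothD; under eq_fun do rewrite expr2; apply: smoothM.
Qed.

Lemma derive1_coord n (c : R -> 'rV[R]_n) i :
  differentiable (c : R^o -> 'rV[R]_n) 0 ->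
  derive1 c 0 0 i = derive1 (fun h => c h 0 i : R^o) 0.
Proof. by move=> dc; rewrite !derive1E (@derive_coord _ R^o). Qed.

Lemma derive1_coord_eq m n (c : R -> 'rV[R]_m) (e : R -> 'rV[R]_n) i j :
  differentiable (c : R^o -> 'rV[R]_m) 0 ->
  differentiable (e : R^o -> 'rV[R]_n) 0 ->
  (forall h, c h 0 i = e h 0 j) -> derive1 c 0 0 i = derive1 e 0 0 j.
Proof.
move=> dc de ce; rewrite !derive1_coord//.
by have -> : (fun h => c h 0 i : R^o) = (fun h => e h 0 j) by exact/funext.
Qed.

Lemma derive1_coord_near n (c : R -> 'rV[R]_n) i a :
  differentiable (c : R^o -> 'rV[R]_n) 0 ->
  (\forall h \near (0 : R^o), c h 0 i = a) -> derive1 c 0 0 i = 0.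
Proof.
move=> dc ca; rewrite derive1_coord// derive1E.
by rewrite (@near_eq_derive _ R^o _ _ (cst a) 0 1 ca) derive_cst.
Qed.

(** Reduces the isometry to a comparison of quadratic forms. [T] has no (u, v) part and [P] no (t,
    s) part, because those coordinates are constant along the respective base leaf for small h. *)
Lemma ex_Psi_velocity y0 y z (c : R -> 'rV[R]_(10 + 10)) : ex_domain y0 ->
  curve_at (product_manifold (ex_MT y0) (ex_Mth y0))
    (row_mx (ex_param y) (ex_param z)) c ->
  exists T P : 'rV[R]_4,
    [/\ lsubmx (derive1 c 0) = ex_dparam y T, rsubmx (derive1 c 0) = ex_dparam z P,
        derive1 (ex_Psi \o c) 0 = ex_dparam (mix y z) (mix T P),
        T 0 2 = 0 /\ T 0 3 = 0 & P 0 0 = 0 /\ P 0 1 = 0].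
Proof.
move=> D0 /curve_at_near[c0 dc Ac].
pose l := lsubmx \o c; pose r := rsubmx \o c.
have dl : differentiable (l : R^o -> 'rV[R]_10) 0.
  by apply: (@differentiable_comp _ R^o); last exact: differentiable_lsubmx.
have dr : differentiable (r : R^o -> 'rV[R]_10) 0.
  by apply: (@differentiable_comp _ R^o); last exact: differentiable_rsubmx.
have Dl : derive1 l 0 = lsubmx (derive1 c 0).
  by apply/rowP => j; rewrite mxE; apply: derive1_coord_eq => // h; rewrite /l /= mxE.
have Dr : derive1 r 0 = rsubmx (derive1 c 0).
  by apply/rowP => j; rewrite mxE; apply: derive1_coord_eq => // h; rewrite /r /= mxE.
have l0 : ex_coords (l 0) = y by rewrite /l /= c0 row_mxKl ex_paramK.
have r0 : ex_coords (r 0) = z by rewrite /r /= c0 row_mxKr ex_paramK.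
have Al : \forall h \near (0 : R^o), ex_MT y0 (l h) by apply: filterS Ac => h [].
have Ar : \forall h \near (0 : R^o), ex_Mth y0 (r h) by apply: filterS Ac => h [].
have [dt Dt] := derive1_retract smooth_ex_param ex_coords_diff (@ex_paramK R) dl Al.
have [dp Dp] := derive1_retract smooth_ex_param ex_coords_diff (@ex_paramK R) dr Ar.
set T := derive1 (ex_coords \o l) 0 in Dt; set P := derive1 (ex_coords \o r) 0 in Dp.
exists T, P; split.
- by rewrite -Dl Dt derive_ex_param l0.
- by rewrite -Dr Dp derive_ex_param r0.
(* The coordinate curve of [ex_Psi \o c]. *)
- pose s h := mix (ex_coords (l h)) (ex_coords (r h)).
  have ds : differentiable (s : R^o -> 'rV[R]_4) 0.
    have dtk k : differentiable (fun h : R^o => ex_coords (l h) 0 k : R^o) 0.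
      apply: (@differentiable_comp _ R^o _ _ (ex_coords \o l) (fun M => M 0 k : R^o)) => //.
      exact: differentiable_coord.
    have dpk k : differentiable (fun h : R^o => ex_coords (r h) 0 k : R^o) 0.
      apply: (@differentiable_comp _ R^o _ _ (ex_coords \o r) (fun M => M 0 k : R^o)) => //.
      exact: differentiable_coord.
    apply: (@differentiable_mx _ R^o) => i [j j4]; under eq_fun do rewrite mxE.
    by do 4?[case: j j4 => [|j] j4 /=; first exact: dtk || exact: dpk].
  have Ds : derive1 s 0 = mix T P.
    by apply: row4P; rewrite mixE; apply: derive1_coord_eq => // h; rewrite mixE.
  rewrite (_ : ex_Psi \o c = @ex_param R \o s)// derive1E.
  rewrite (@derive_comp _ R^o)//; last exact: ex_param_diff.
  by rewrite -derive1E Ds derive_ex_param /s l0 r0.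
- split; [apply: (derive1_coord_near (a := y0 0 2)) => //
          |apply: (derive1_coord_near (a := y0 0 3)) => //];
  by apply: filterS Al => h [y' [_ e2 e3] yE]; rewrite /= -yE ex_paramK.
- split; [apply: (derive1_coord_near (a := y0 0 0)) => //
          |apply: (derive1_coord_near (a := y0 0 1)) => //];
  by apply: filterS Ar => h [y' [_ e2 e3] yE]; rewrite /= -yE ex_paramK.
Qed.

Lemma ip_warped_metric m n (gB : 'rV[R]_m -> 'M[R]_m) (gF : 'rV[R]_n -> 'M[R]_n)
    (f : 'rV[R]_m -> R) (z X Y : 'rV[R]_(m + n)) :
  ip (warped_metric gB gF f) z X Y =
  ip gB (lsubmx z) (lsubmx X) (lsubmx Y) +
  f (lsubmx z) ^+ 2 * ip gF (rsubmx z) (rsubmx X) (rsubmx Y).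
Proof.
rewrite /ip /warped_metric -{1}(hsubmxK X) -{1}(hsubmxK Y) tr_row_mx.
rewrite mul_row_block !mulmx0 addr0 add0r mul_row_col mxE.
by rewrite -scalemxAr -scalemxAl [X in _ + X]mxE.
Qed.

Lemma ex_Psi_isometry y0 : ex_domain y0 ->
  riemannian_isometry (product_manifold (ex_MT y0) (ex_Mth y0))
    (warped_metric g (ex_gth y0) ex_f) (@ex_M R) g ex_Psi.
Proof.
move=> D0.
have PsiE y z : ex_Psi (row_mx (ex_param y) (ex_param z)) = ex_param (mix y z).
  by rewrite /ex_Psi row_mxKl row_mxKr !ex_paramK.
have prodP x : product_manifold (ex_MT y0) (ex_Mth y0) x -> exists y z,
    [/\ x = row_mx (ex_param y) (ex_param z), ex_domain y /\ ex_domain z,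
        y 0 2 = y0 0 2 /\ y 0 3 = y0 0 3 & z 0 0 = y0 0 0 /\ z 0 1 = y0 0 1].
  move=> [[y [Dy y2 y3] yE] [z [Dz z0 z1] zE]]; exists y, z; split=> //.
  by rewrite yE zE hsubmxK.
split.
- by apply: smooth_smooth_on; exact: smooth_ex_Psi.
- rewrite predeqE => x; split.
    move=> [_ /prodP[y [z [-> [Dy Dz] _ _]]] <-]; rewrite PsiE.
    by exists (mix y z) => //; exact: mix_domain.
  move=> [y Dy <-]; exists (row_mx (ex_param (mix y y0)) (ex_param (mix y0 y))).
    rewrite /product_manifold/= row_mxKl row_mxKr; split.
      by exists (mix y y0) => //; split; rewrite ?mixE//; exact: mix_domain.
    by exists (mix y0 y) => //; split; rewrite ?mixE//; exact: mix_domain.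
  by rewrite PsiE; congr ex_param; apply: row4P; rewrite !mixE.
- exists (ex_Psi_inv y0); split.
    by apply: smooth_smooth_on; exact: smooth_ex_Psi_inv.
  move=> _ /prodP[y [z [-> _ [y2 y3] [z0 z1]]]]; rewrite PsiE /ex_Psi_inv ex_paramK.
  by congr row_mx; congr ex_param; apply: row4P; rewrite !mixE.
move=> _ c1 c2 /prodP[y [z [-> _ _ [z0 z1]]]] C1 C2.
have [T [P [T1 P1 S1 [T12 T13] [P10 P11]]]] := ex_Psi_velocity D0 C1.
have [T' [P' [T1' P1' S1' [T12' T13'] [P10' P11']]]] := ex_Psi_velocity D0 C2.
rewrite ip_warped_metric T1 P1 S1 T1' P1' S1' row_mxKl row_mxKr.
rewrite /ex_f ex_paramK sqr_sqrtr ?ltW ?ex_w_gt0//.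
have -> (x X Y : 'rV[R]_10) : ip (ex_gth y0) x X Y = (ex_w y0)^-1 * ip g x X Y.
  by rewrite /ip /ex_gth -scalemxAr -scalemxAl mxE.
rewrite !ip_ex_dparam !mixE T12 T13 T12' T13' P10 P11 P10' P11'.
have -> : ex_w z = ex_w y0 by rewrite /ex_w z0 z1.
have -> : ex_w (mix y z) = ex_w y by rewrite /ex_w !mixE.
(* On the slant factor f^2 = w(y) meets the normalization 1 / w(y0) and the induced factor w(z) =
   w(y0), leaving w(y), as in the Gram matrix at [mix y z]. *)
by field; rewrite gt_eqF// ex_w_gt0.
Qed.

(** Fixing one factor of the product sweeps out a whole leaf, so the slice conditions of the warped
    product reduce to the integrality of leaves through arbitrary points. *)
Lemma ex_Psi_leaves y0 : ex_domain y0 ->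
  (forall z, ex_domain z -> z 0 0 = y0 0 0 -> z 0 1 = y0 0 1 ->
     [set ex_Psi (row_mx p (ex_param z)) | p in ex_MT y0] = ex_MT z) /\
  (forall y, ex_domain y -> y 0 2 = y0 0 2 -> y 0 3 = y0 0 3 ->
     [set ex_Psi (row_mx (ex_param y) q) | q in ex_Mth y0] = ex_Mth y).
Proof.
move=> D0.
have PsiE y z : ex_Psi (row_mx (ex_param y) (ex_param z)) = ex_param (mix y z).
  by rewrite /ex_Psi row_mxKl row_mxKr !ex_paramK.
split=> z Dz zE1 zE2; rewrite predeqE => x; split.
- move=> [_ [y [Dy y2 y3] <-] <-]; rewrite PsiE.
  by exists (mix y z) => //; split; rewrite ?mixE//; exact: mix_domain.
- move=> [y [Dy y2 y3] <-]; exists (ex_param (mix y y0)).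
    by exists (mix y y0) => //; split; rewrite ?mixE//; exact: mix_domain.
  by rewrite PsiE; congr ex_param; apply: row4P; rewrite !mixE.
- move=> [_ [y [Dy y2 y3] <-] <-]; rewrite PsiE.
  by exists (mix z y) => //; split; rewrite ?mixE//; exact: mix_domain.
- move=> [y [Dy y2 y3] <-]; exists (ex_param (mix y0 y)).
    by exists (mix y0 y) => //; split; rewrite ?mixE//; exact: mix_domain.
  by rewrite PsiE; congr ex_param; apply: row4P; rewrite !mixE.
Qed.

Lemma warped_product_semi_slant_ex y0 : ex_domain y0 ->
  warped_product_semi_slant g J (@ex_M R) (@ex_DT R) (@ex_Dth R) ex_theta
    (ex_MT y0) g (ex_Mth y0) (ex_gth y0) ex_f ex_Psi.
Proof.
move=> D0; split.
- exact: pointwise_semi_slant_ex.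
- by split; [exact: integral_manifold_MT|exact: holomorphic_ex_MT].
- by split; [exact: integral_manifold_Mth|exact: proper_slant_ex_Mth].
- have [lT lth] := ex_Psi_leaves D0; split.
  + split; first exact: riemannian_euclidean.
    by apply: riemannian_scalar; rewrite invr_gt0 ex_w_gt0.
  + split; first by apply: smooth_smooth_on; exact: smooth_ex_f.
    by move=> p _; rewrite sqrtr_gt0 ex_w_gt0.
  + exact: ex_Psi_isometry.
  + by move=> _ [z [Dz z0 z1] <-]; rewrite lT//; exact: integral_manifold_MT.
  + by move=> _ [y [Dy y2 y3] <-]; rewrite lth//; exact: integral_manifold_Mth.
have [_ _ d2 d3] := D0.
(* The values 2 and 3 avoid the excluded 0 and 1, and w takes the different values 9 and 14. *)
exists (ex_param (row4 2 2 (y0 0 2) (y0 0 3))), (ex_param (row4 3 2 (y0 0 2) (y0 0 3))).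
split.
- exists (row4 2 2 (y0 0 2) (y0 0 3)) => //; split; rewrite ?row4E//.
  by split; rewrite !row4E//; split; apply/eqP => ?; lra.
- exists (row4 3 2 (y0 0 2) (y0 0 3)) => //; split; rewrite ?row4E//.
  by split; rewrite !row4E//; split; apply/eqP => ?; lra.
rewrite /ex_f !ex_paramK eqr_sqrt ?ltW ?ex_w_gt0// /ex_w !row4E.
by apply/eqP => e; lra.
Qed.

End warped_example.

Theorem mainTheorem3 (R : realType) :
  (exists (n : nat) (g J : 'rV[R]_n -> 'M[R]_n), kaehler g J /\
     exists (M : set 'rV[R]_n) (DT Dth : 'rV[R]_n -> set 'rV[R]_n)
            (theta : 'rV[R]_n -> R) (kT kth : nat)
            (MT : set 'rV[R]_n) (gT : 'rV[R]_n -> 'M[R]_n)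
            (Mth : set 'rV[R]_n) (gth : 'rV[R]_n -> 'M[R]_n)
            (f : 'rV[R]_n -> R) (Psi : 'rV[R]_(n + n) -> 'rV[R]_n),
       [/\ (0 < kT)%N /\ submanifold kT MT, (0 < kth)%N /\ submanifold kth Mth &
           warped_product_semi_slant g J M DT Dth theta MT gT Mth gth f Psi])
  /\
  let g := @euclidean_metric R 10 in
  let J := @canonical_J R in
  let M := @ex_M R in
  let DT := @ex_DT R in
  let Dth := @ex_Dth R in
  [/\ kaehler g J,
      submanifold 4 M /\ parametrizes (@ex_domain R) (@ex_param R) M,
      smooth_distribution 2 M DT /\ smooth_distribution 2 M Dth,
      integrable_distribution M DT /\ integrable_distribution M Dth &
      (forall y Y Z : 'rV[R]_4, ex_domain y ->
         ip g (ex_param y) ('D_Y (@ex_param R) y) ('D_Z (@ex_param R) y) =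
         2 * (Y 0 0 * Z 0 0) + 2 * (Y 0 1 * Z 0 1)
         + (y 0 0 ^+ 2 + y 0 1 ^+ 2 + 1) * (Y 0 2 * Z 0 2 + Y 0 3 * Z 0 3))]
  /\
  exists theta f : 'rV[R]_10 -> R,
    [/\ (forall y, ex_domain y ->
           theta (ex_param y) = acos (1 / (y 0 0 ^+ 2 + y 0 1 ^+ 2 + 1))),
        (forall y, ex_domain y ->
           f (ex_param y) = Num.sqrt (y 0 0 ^+ 2 + y 0 1 ^+ 2 + 1)),
        pointwise_semi_slant g J M DT Dth theta &
        forall y0 : 'rV[R]_4, ex_domain y0 ->
          exists Psi : 'rV[R]_(10 + 10) -> 'rV[R]_10,
            (forall y z, ex_domain y -> ex_domain z ->
               y 0 2 = y0 0 2 -> y 0 3 = y0 0 3 ->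
               z 0 0 = y0 0 0 -> z 0 1 = y0 0 1 ->
               Psi (row_mx (ex_param y) (ex_param z)) =
               ex_param (\row_(i < 4) if (i < 2)%N then y 0 i else z 0 i)) /\
            warped_product_semi_slant g J M DT Dth theta
              (ex_MT y0) g (ex_Mth y0) (ex_gth y0) f Psi].
Proof.
have PsiE (y z : 'rV[R]_4) : ex_Psi (row_mx (ex_param y) (ex_param z)) =
    ex_param (\row_(i < 4) if (i < 2)%N then y 0 i else z 0 i).
  rewrite /ex_Psi row_mxKl row_mxKr !ex_paramK; congr ex_param.
  by apply: row4P; rewrite mixE !mxE.
split.
  exists 10, (@euclidean_metric R 10), (@canonical_J R).
  split; first exact: kaehler_canonical_J.
  (* Any point of the domain would do as base point. *)
  pose y0 : 'rV[R]_4 := row4 2 2 (pi / 4) (pi / 4).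
  have D0 : ex_domain y0.
    have := pi_gt0 R => pi0.
    by split; rewrite !row4E; [split; apply/eqP => ?; lra|split; apply/eqP => ?; lra| |];
      apply/andP; split; lra.
  exists (@ex_M R), (@ex_DT R), (@ex_Dth R), ex_theta, 2, 2, (ex_MT y0),
    (@euclidean_metric R 10), (ex_Mth y0), (ex_gth y0), ex_f, ex_Psi.
  split; last exact: warped_product_semi_slant_ex.
    by split=> //; rewrite ex_MT_slice; exact: submanifold_slice T_mxK.
  by split=> //; rewrite ex_Mth_slice; exact: submanifold_slice th_mxK.
move=> g J M DT Dth; split.
  split.
  - exact: kaehler_canonical_J.
  - split.
      by rewrite /M ex_M_slice; apply: submanifold_slice; exact: mulmx1.
    apply: (parametrizes_retract smooth_ex_param ex_coords_diff (@ex_paramK R)).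
    exact: open_ex_domain.
  - split; first exact: smooth_distribution_frame T_mxK ex_DT_mx.
    exact: smooth_distribution_frame th_mxK ex_Dth_mx.
  - split=> _ [y Dy <-].
      by exists (ex_MT y); split; [exact: integral_manifold_MT|exists y].
    by exists (ex_Mth y); split; [exact: integral_manifold_Mth|exists y].
  - by move=> y Y Z Dy; rewrite !derive_ex_param ip_ex_dparam.
exists ex_theta, ex_f; split.
- by move=> y Dy; rewrite /ex_theta ex_paramK.
- by move=> y Dy; rewrite /ex_f ex_paramK.
- exact: pointwise_semi_slant_ex.
move=> y0 D0; exists ex_Psi; split; first by move=> *; exact: PsiE.
exact: warped_product_semi_slant_ex.
Qed.
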